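(* For every positive integer $n$, every integer $m\ge2$ and all $x,y\in\mathbb{R}^m\setminus\{0\}$, the kernel of the $(0,2/n)$-generalized Fourier transform satisfies $|K^{m}_{2/n}(x,y)|\le1$.
   Context: For $a>0$, $m\ge2$, $\lambda=(m-2)/2$, $z=|x||y|$, $\xi=\langle x,y\rangle/z$, the kernel is $K_{a}^{m}(x,y)=a^{2\lambda/a}\Gamma(\frac{2\lambda+a}{a})\sum_{j=0}^{\infty}e^{-\frac{i\pi j}{a}}\frac{\lambda+j}{\lambda}z^{-\lambda}J_{\frac{2(j+\lambda)}{a}}(\frac{2}{a}z^{a/2})C^{\lambda}_{j}(\xi)$, with $J_\nu$ the Bessel function, $C_j^\lambda$ the Gegenbauer polynomial, and for $\lambda=0$ the factor $\frac{\lambda+j}{\lambda}C_j^\lambda(\xi)$ understood as its limit as $\lambda\to0$. *)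

(* Defs.v *)
From Stdlib Require Import Reals Factorial.
From Coquelicot Require Import Coquelicot.
Open Scope R_scope.

Definition Gamma (s : R) : R :=
  RInt_gen (fun t => Rpower t (s - 1) * exp (- t)) (at_right 0) (Rbar_locally p_infty).

Definition BesselJ (nu t : R) : R :=
  Series (fun k => (-1) ^ k / (INR (Factorial.fact k) * Gamma (INR k + nu + 1))
                   * Rpower (t / 2) (2 * INR k + nu)).

(* Gegenbauer polynomials via the standard three-term recurrence:
   C_0 = 1, C_1 = 2 lam x,
   (j+1) C_{j+1} = 2 x (j+lam) C_j - (j + 2 lam - 1) C_{j-1}.
   geg_pair lam x j = (C_j^lam(x), C_{j+1}^lam(x)). *)
Fixpoint geg_pair (lam x : R) (j : nat) : R * R :=
  match j with
  | O => (1, 2 * lam * x)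
  | S j' => let (c0, c1) := geg_pair lam x j' in
            (c1, (2 * x * (INR j + lam) * c1 - (INR j + 2 * lam - 1) * c0) / (INR j + 1))
  end.

Definition Gegenbauer (lam : R) (j : nat) (x : R) : R := fst (geg_pair lam x j).

Definition geg_factor (lam : R) (j : nat) (xi : R) : R :=
  if Req_EM_T lam 0
  then real (Lim (fun l => (l + INR j) / l * Gegenbauer l j xi) 0)
  else (lam + INR j) / lam * Gegenbauer lam j xi.

(* Vectors of R^m: functions nat -> R, only the coordinates 0..m-1 are used. *)
Definition dotm (m : nat) (x y : nat -> R) : R :=
  match m with O => 0 | S m' => sum_f_R0 (fun i => x i * y i) m' end.
Definition normm (m : nat) (x : nat -> R) : R := sqrt (dotm m x x).
Definition nonzero_vec (m : nat) (x : nat -> R) : Prop := exists i, (i < m)%nat /\ x i <> 0.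

Definition kernel_coef (a : R) (m : nat) (x y : nat -> R) (j : nat) : R :=
  let lam := (INR m - 2) / 2 in
  let z := normm m x * normm m y in
  let xi := dotm m x y / z in
  Rpower a (2 * lam / a) * Gamma ((2 * lam + a) / a)
  * geg_factor lam j xi * Rpower z (- lam)
  * BesselJ (2 * (INR j + lam) / a) (2 / a * Rpower z (a / 2)).

(* K_a^m(x,y) = sum_j e^{-i pi j / a} * kernel_coef j, as a complex number
   (real part, imaginary part), with e^{-i t} = cos t - i sin t. *)
Definition Kernel (a : R) (m : nat) (x y : nat -> R) : C :=
  (Series (fun j => cos (PI * INR j / a) * kernel_coef a m x y j),
   Series (fun j => - sin (PI * INR j / a) * kernel_coef a m x y j)).

(* Main.v *)
Require Import Defs.
From Stdlib Require Import Reals Lra Lia ZArith Factorial.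
From Coquelicot Require Import Coquelicot.
Open Scope R_scope.

(** Write [lam = (m - 2) / 2], [nu = n lam], [xi = cos th] and [w = n z^(1/n)].  Up to phases,
    the kernel is the sum over [j] of [geg_factor lam j xi] against Bessel functions of order
    [nu + n j].  By Gegenbauer's expansion of a plane wave, [exp (- i w u)] is the sum over all
    [N] of [geg_factor nu N u] against the Bessel functions of order [nu + N].  So the kernel is
    the characteristic function [E exp (- i w u)], and has modulus at most 1, as soon as [E] is
    the expectation of a law on [[-1, 1]] such that [E (geg_factor nu N)] is
    [geg_factor lam j xi] if [N = n j], and [0] if [n] does not divide [N].

    Let [c_k = cos ((th + 2 pi k) / n)].  For [lam = 0] the uniform law on the [c_k] has this
    property.  For [lam > 0] it is the law of [sum_k t_k c_k], where [t] follows the Dirichlet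
    law with all parameters [lam]: then the generating functions of both sides agree, since
    [E (1 - 2 u s + s^2)^(-nu) = prod_k (1 - 2 c_k s + s^2)^(-lam)] and
    [prod_k (1 - 2 c_k s + s^2) = 1 - 2 xi s^n + s^(2n)].

    The Dirichlet law is built one coordinate at a time by Beta laws; as [2 lam] is an integer,
    the substitution [t = sin^2 phi] makes them continuous densities on [[0, pi/2]]. *)

(** * Finite sums and series *)

Lemma is_series_is_lim_seq (a : nat -> R) (l : R) :
  is_series a l <-> is_lim_seq (sum_f_R0 a) l.
Proof.
  split; intros Ha.
  - apply is_lim_seq_ext with (sum_n a); [intros; apply sum_n_Reals|exact Ha].
  - change (is_lim_seq (sum_n a) l).
    apply is_lim_seq_ext with (sum_f_R0 a); [|exact Ha].
    intros; symmetry; apply sum_n_Reals.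
Qed.

Lemma is_series_Rmult_l (c : R) (a : nat -> R) (l : R) :
  is_series a l -> is_series (fun k => c * a k) (c * l).
Proof. exact (is_series_scal (V := R_NormedModule) c a l). Qed.

Lemma is_series_Rplus (a b : nat -> R) (la lb : R) :
  is_series a la -> is_series b lb -> is_series (fun k => a k + b k) (la + lb).
Proof. exact (is_series_plus (V := R_NormedModule) a b la lb). Qed.

Lemma is_series_ext_R (a b : nat -> R) (l : R) :
  (forall k, a k = b k) -> is_series a l -> is_series b l.
Proof. exact (is_series_ext (V := R_NormedModule) a b l). Qed.

Lemma ex_series_Rabs_le (a b : nat -> R) :
  (forall k, Rabs (a k) <= b k) -> ex_series b -> ex_series a.
Proof. exact (ex_series_le (V := R_CompleteNormedModule) a b). Qed.

Lemma is_series_exp x : is_series (fun p => x ^ p / INR (fact p)) (exp x).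
Proof.
  apply is_series_ext_R with (fun p => / INR (fact p) * x ^ p).
  - intros p. apply Rmult_comm.
  - apply is_pseries_R, is_exp_Reals.
Qed.

Lemma sum_f_R0_Rmult_l (c : R) (f : nat -> R) n :
  sum_f_R0 (fun k => c * f k) n = c * sum_f_R0 f n.
Proof. rewrite scal_sum. apply sum_eq. intros; ring. Qed.

Lemma sum_f_R0_rev (f : nat -> R) n :
  sum_f_R0 (fun k => f (n - k)%nat) n = sum_f_R0 f n.
Proof.
  induction n as [|n IH]; [easy|].
  rewrite decomp_sum by lia. cbn [Nat.pred]. rewrite Nat.sub_0_r.
  rewrite (sum_eq _ (fun k => f (n - k)%nat)) by (intros; f_equal; lia).
  rewrite IH. simpl. ring.
Qed.

Lemma sum_f_R0_add_shift (f g : nat -> R) n :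
  sum_f_R0 (fun k => f k + g (S k)) n =
  sum_f_R0 (fun k => f k + g k) n + g (S n) - g 0%nat.
Proof. induction n as [|n IH]; simpl; [ring|]. rewrite IH. ring. Qed.

Lemma is_lim_seq_sum_f_R0 (u : nat -> nat -> R) (v : nat -> R) n :
  (forall k, is_lim_seq (fun i => u i k) (v k)) ->
  is_lim_seq (fun i => sum_f_R0 (u i) n) (sum_f_R0 v n).
Proof.
  intros Hu. induction n as [|n IH]; simpl; [apply Hu|].
  now apply is_lim_seq_plus'.
Qed.

Lemma Rabs_sum_f_R0_diff_le (a b : nat -> R) n m :
  (forall k, Rabs (a k) <= b k) -> (n <= m)%nat ->
  Rabs (sum_f_R0 a m - sum_f_R0 a n) <= sum_f_R0 b m - sum_f_R0 b n.
Proof.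
  intros Hab Hnm. induction Hnm as [|m _ IH].
  - rewrite !Rminus_diag, Rabs_R0. lra.
  - simpl. replace (sum_f_R0 a m + a (S m) - sum_f_R0 a n)
      with ((sum_f_R0 a m - sum_f_R0 a n) + a (S m)) by ring.
    generalize (Rabs_triang (sum_f_R0 a m - sum_f_R0 a n) (a (S m))) (Hab (S m)). lra.
Qed.

Lemma is_series_tail_le (a b : nat -> R) la lb n :
  (forall k, Rabs (a k) <= b k) -> is_series a la -> is_series b lb ->
  Rabs (la - sum_f_R0 a n) <= lb - sum_f_R0 b n.
Proof.
  intros Hab Ha Hb. apply is_series_is_lim_seq in Ha, Hb.
  change (Rbar_le (Rabs (la - sum_f_R0 a n)) (lb - sum_f_R0 b n)).
  apply (is_lim_seq_le_loc (fun m => Rabs (sum_f_R0 a m - sum_f_R0 a n))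
    (fun m => sum_f_R0 b m - sum_f_R0 b n)).
  - exists n. intros m. now apply Rabs_sum_f_R0_diff_le.
  - apply (is_lim_seq_abs _ (la - sum_f_R0 a n)).
    apply is_lim_seq_minus'; [easy|apply is_lim_seq_const].
  - apply is_lim_seq_minus'; [easy|apply is_lim_seq_const].
Qed.

Lemma is_lim_seq_Tannery_sum (f : nat -> nat -> R) (B : nat -> R) :
  ex_series B -> (forall Q N, Rabs (f Q N) <= B N) ->
  (forall N, is_lim_seq (fun Q => f Q N) 0) ->
  is_lim_seq (fun Q => sum_f_R0 (f Q) Q) 0.
Proof.
  intros [b Hb] Hdom Hlim. apply is_series_is_lim_seq, is_lim_seq_spec in Hb.
  apply is_lim_seq_spec. intros eps.
  assert (Heps : 0 < eps / 4) by (destruct eps; simpl; lra).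
  destruct (Hb (mkposreal _ Heps)) as [N0 Htail]; simpl in Htail.
  assert (Hhead := is_lim_seq_sum_f_R0 f (fun _ => 0) N0 Hlim).
  rewrite sum_eq_R0 in Hhead by easy. apply is_lim_seq_spec in Hhead.
  destruct (Hhead (mkposreal _ Heps)) as [Q0 Hsmall]; simpl in Hsmall.
  exists (max N0 Q0). intros Q HQ.
  assert (HheadQ := Hsmall Q ltac:(lia)).
  assert (HtailN := Htail N0 (le_n _)). assert (HtailQ := Htail Q ltac:(lia)).
  assert (Hdiff := Rabs_sum_f_R0_diff_le (f Q) B N0 Q (Hdom Q) ltac:(lia)).
  apply Rabs_def2 in HheadQ, HtailN, HtailQ. apply Rabs_le_between in Hdiff.
  apply Rabs_def1; lra.
Qed.

Definition PS_dilate (n : nat) (f : nat -> R) (N : nat) : R :=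
  if Nat.eqb (N mod n) 0 then f (N / n)%nat else 0.

Lemma PS_dilate_ext n f g N :
  (forall j, N = (n * j)%nat -> f j = g j) -> PS_dilate n f N = PS_dilate n g N.
Proof.
  intros Hfg. unfold PS_dilate. destruct (Nat.eqb_spec (N mod n) 0) as [Hmod|_]; [|easy].
  apply Hfg. rewrite (Nat.div_mod_eq N n) at 1. lia.
Qed.

Lemma PS_dilate_Rmult_l n c f N : PS_dilate n (fun j => c * f j) N = c * PS_dilate n f N.
Proof. unfold PS_dilate. destruct (Nat.eqb _ _); ring. Qed.

Lemma sum_f_R0_PS_dilate n f M : (0 < n)%nat ->
  sum_f_R0 (PS_dilate n f) M = sum_f_R0 f (M / n).
Proof.
  intros Hn. induction M as [|M IH].
  - unfold PS_dilate; simpl. now rewrite Nat.Div0.mod_0_l, Nat.Div0.div_0_l.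
  - rewrite tech5, IH. unfold PS_dilate.
    assert (HM := Nat.div_mod_eq M n). assert (HSM := Nat.div_mod_eq (S M) n).
    assert (HMn := Nat.mod_upper_bound M n). assert (HSMn := Nat.mod_upper_bound (S M) n).
    destruct (Nat.eqb_spec (S M mod n) 0) as [Hmod|Hmod].
    + replace (S M / n)%nat with (S (M / n)) by nia. easy.
    + replace (S M / n)%nat with (M / n)%nat by nia. ring.
Qed.

Lemma is_series_PS_dilate n (f : nat -> R) (l : R) : (0 < n)%nat ->
  is_series (PS_dilate n f) l <-> is_series f l.
Proof.
  intros Hn. rewrite !is_series_is_lim_seq. split; intros Hf.
  - apply is_lim_seq_ext with (fun J => sum_f_R0 (PS_dilate n f) (J * n)).
    { intros J. now rewrite sum_f_R0_PS_dilate, Nat.div_mul by lia. }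
    apply (is_lim_seq_subseq (sum_f_R0 (PS_dilate n f)) l (fun J => J * n)%nat); [|exact Hf].
    apply eventually_subseq. intros; lia.
  - apply is_lim_seq_ext with (fun M => sum_f_R0 f (M / n)).
    { intros; symmetry; now apply sum_f_R0_PS_dilate. }
    apply (filterlim_comp _ _ _ (fun M => M / n)%nat (sum_f_R0 f) _ eventually); [|exact Hf].
    intros P [N0 HN]. exists (N0 * n)%nat. intros M HM. apply HN.
    now apply Nat.div_le_lower_bound; [lia|rewrite Nat.mul_comm].
Qed.

Lemma is_series_PS_dilate_pow n (f : nat -> R) (s l : R) : (0 < n)%nat ->
  is_series (fun j => f j * (s ^ n) ^ j) l ->
  is_series (fun N => PS_dilate n f N * s ^ N) l.
Proof.
  intros Hn Hf. apply (is_series_PS_dilate n) in Hf; [|easy].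
  apply is_series_ext_R with (2 := Hf). intros N.
  rewrite Rmult_comm, <- PS_dilate_Rmult_l. apply PS_dilate_ext.
  intros j ->. rewrite pow_mult. ring.
Qed.

Lemma sum_f_R0_diagonals (a : nat -> nat -> R) Q :
  sum_f_R0 (fun P => sum_f_R0 (fun k => a (P - 2 * k)%nat k) (P / 2)) Q =
  sum_f_R0 (fun N => sum_f_R0 (a N) ((Q - N) / 2)) Q.
Proof.
  induction Q as [|Q IH]; [easy|].
  rewrite tech5, IH.
  transitivity (sum_f_R0 (fun N => sum_f_R0 (a N) ((Q - N) / 2)) Q +
    sum_f_R0 (fun N => PS_dilate 2 (a N) (S Q - N)) (S Q)).
  - f_equal. rewrite <- (sum_f_R0_rev (fun N => PS_dilate 2 (a N) (S Q - N))).
    rewrite <- (sum_f_R0_PS_dilate 2) by lia. apply sum_eq. intros k Hk.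
    replace (S Q - (S Q - k))%nat with k by lia.
    apply PS_dilate_ext. now intros j ->.
  - rewrite !(tech5 _ Q), <- Rplus_assoc, <- plus_sum. f_equal.
    + apply sum_eq. intros N HN.
      replace (S Q - N)%nat with (S (Q - N)) by lia.
      rewrite <- !(sum_f_R0_PS_dilate 2) by lia. now rewrite tech5.
    + now rewrite Nat.sub_diag.
Qed.

Lemma is_series_diagonals (a : nat -> nat -> R) (S B : nat -> R) (l : R) :
  (forall N, is_series (a N) (S N)) ->
  (forall N, is_series (fun k => Rabs (a N k)) (B N)) ->
  ex_series B -> is_series S l ->
  is_series (fun P => sum_f_R0 (fun k => a (P - 2 * k)%nat k) (P / 2)) l.
Proof.
  intros Ha Habs HB HS. apply is_series_is_lim_seq.
  set (row_error Q N := if Nat.leb N Q then S N - sum_f_R0 (a N) ((Q - N) / 2) else 0).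
  apply is_lim_seq_ext with (fun Q => sum_f_R0 S Q - sum_f_R0 (row_error Q) Q).
  { intros Q. rewrite sum_f_R0_diagonals, <- minus_sum.
    apply sum_eq. intros N HN. unfold row_error. apply Nat.leb_le in HN. rewrite HN. ring. }
  replace l with (l - 0) by ring.
  apply is_lim_seq_minus'; [now apply is_series_is_lim_seq|].
  apply (is_lim_seq_Tannery_sum _ B HB); unfold row_error.
  - intros Q N. assert (Hrow := fun n =>
      is_series_tail_le _ _ _ _ n (fun k => Rle_refl _) (Ha N) (Habs N)).
    assert (Hnonneg : forall n, 0 <= sum_f_R0 (fun k => Rabs (a N k)) n)
      by (intros n; apply cond_pos_sum; intros; apply Rabs_pos).
    destruct (Nat.leb N Q).
    + generalize (Hrow ((Q - N) / 2)%nat) (Hnonneg ((Q - N) / 2)%nat). lra.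
    + rewrite Rabs_R0.
      generalize (Hrow 0%nat) (Hnonneg 0%nat) (Rabs_pos (S N - sum_f_R0 (a N) 0)). lra.
  - intros N.
    apply is_lim_seq_ext_loc with (fun Q => S N - sum_f_R0 (a N) ((Q - N) / 2)).
    { exists N. intros Q HQ. apply Nat.leb_le in HQ. now rewrite HQ. }
    replace (Finite 0) with (Finite (S N - S N)) by (f_equal; ring).
    apply is_lim_seq_minus'; [apply is_lim_seq_const|].
    apply (filterlim_comp _ _ _ (fun Q => (Q - N) / 2)%nat (sum_f_R0 (a N)) _ eventually).
    + intros P [N0 HN0]. exists (N + N0 * 2)%nat. intros Q HQ. apply HN0.
      apply Nat.div_le_lower_bound; lia.
    + apply (proj1 (is_series_is_lim_seq (a N) (S N))), Ha.
Qed.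

(** * Power series *)

Lemma Rlt_Rinv_antitone x a b : 0 < a <= b -> x < / b -> x < / a.
Proof.
  intros Hab Hx. apply Rlt_le_trans with (1 := Hx). apply Rinv_le_contravar; lra.
Qed.

Lemma Rlt_Rinv_lt_1 x b : 1 <= b -> x < / b -> x < 1.
Proof.
  intros Hb Hx. rewrite <- Rinv_1. apply Rlt_Rinv_antitone with b; [lra|easy].
Qed.

Lemma geometric_bound_CV_radius (a : nat -> R) A K x :
  0 < K -> (forall n, Rabs (a n) <= A * K ^ n) -> Rabs x < / K ->
  Rbar_lt (Rabs x) (CV_radius a).
Proof.
  intros HK Ha Hx. apply Rbar_lt_le_trans with (/ K); [exact Hx|].
  apply (proj1 (CV_radius_bounded a)). exists A. intros n.
  assert (HiK : 0 <= / K) by (left; now apply Rinv_0_lt_compat).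
  rewrite Rabs_mult, <- RPow_abs, (Rabs_pos_eq (/ K)) by easy.
  replace A with (A * K ^ n * (/ K) ^ n)
    by (rewrite Rmult_assoc, <- Rpow_mult_distr, Rinv_r, pow1; lra).
  apply Rmult_le_compat_r; [now apply pow_le|apply Ha].
Qed.

Lemma is_pseries_PSeries (a : nat -> R) x :
  Rbar_lt (Rabs x) (CV_radius a) -> is_series (fun n => a n * x ^ n) (PSeries a x).
Proof. intros Hx. now apply is_pseries_R, PSeries_correct, CV_radius_inside. Qed.

Lemma is_series_PS_incr_1 (a : nat -> R) x l :
  is_series (fun n => a n * x ^ n) l ->
  is_series (fun n => PS_incr_1 a n * x ^ n) (x * l).
Proof.
  intros Ha. apply (is_pseries_R (PS_incr_1 a)), (is_pseries_incr_1 a x l).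
  now apply is_pseries_R.
Qed.

Lemma pseries_coef_unique (a b : nat -> R) (f : R -> R) delta : 0 < delta ->
  (forall s, Rabs s < delta -> is_series (fun n => a n * s ^ n) (f s)) ->
  (forall s, Rabs s < delta -> is_series (fun n => b n * s ^ n) (f s)) ->
  forall n, a n = b n.
Proof.
  intros Hdelta Ha Hb n.
  assert (Hrad : forall c : nat -> R,
    (forall s, Rabs s < delta -> is_series (fun n => c n * s ^ n) (f s)) ->
    Rbar_lt 0 (CV_radius c)).
  { intros c Hc. apply Rbar_lt_le_trans with (Rabs (delta / 2)); [apply Rabs_pos_lt; lra|].
    apply Rbar_not_lt_le. intros Hlt. apply (CV_disk_outside _ _ Hlt), ex_series_lim_0.
    exists (f (delta / 2)). apply Hc. rewrite Rabs_pos_eq; lra. }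
  apply PSeries_ext_recip; [now apply Hrad..|].
  exists (mkposreal _ Hdelta). intros s Hs.
  change (Rabs (s - 0) < delta) in Hs. rewrite Rminus_0_r in Hs.
  unfold PSeries. now rewrite (is_series_unique _ _ (Ha s Hs)), (is_series_unique _ _ (Hb s Hs)).
Qed.

Lemma is_derive_zero_constant (f : R -> R) rho x :
  (forall t, Rabs t < rho -> is_derive f t 0) -> Rabs x < rho -> f x = f 0.
Proof.
  intros Hf Hx. apply Rabs_def2 in Hx. destruct (Rtotal_order x 0) as [Hneg|[->|Hpos]]; [|easy|].
  - apply (eq_is_derive (V := R_NormedModule) f); [|easy].
    intros t Ht. apply Hf, Rabs_def1; lra.
  - symmetry. apply (eq_is_derive (V := R_NormedModule) f); [|easy].
    intros t Ht. apply Hf, Rabs_def1; lra.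
Qed.

(** * The Gamma function *)

Lemma continuous_of_ex_derive (f : R -> R) t : ex_derive f t -> continuous f t.
Proof. exact (ex_derive_continuous (K := R_AbsRing) (V := R_NormedModule) f t). Qed.

Lemma ex_RInt_continuous_R (f : R -> R) a b :
  (forall t, Rmin a b <= t <= Rmax a b -> continuous f t) -> ex_RInt f a b.
Proof. exact (ex_RInt_continuous (V := R_CompleteNormedModule) f a b). Qed.

Lemma exp_le_compat x y : x <= y -> exp x <= exp y.
Proof. intros [Hxy| ->]; [left; now apply exp_increasing|apply Rle_refl]. Qed.

Lemma positive_segments_near :
  filter_prod (at_right 0) (Rbar_locally p_infty)
    (fun ab : R * R => forall t, Rmin (fst ab) (snd ab) <= t <= Rmax (fst ab) (snd ab) -> 0 < t).
Proof.
  apply (Filter_prod _ _ _ (fun a => 0 < a) (fun b => 0 < b)).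
  - exists (mkposreal 1 Rlt_0_1). easy.
  - now exists 0.
  - simpl. intros a b Ha Hb t Ht.
    apply Rlt_le_trans with (2 := proj1 Ht). now apply Rmin_glb_lt.
Qed.

Section NonnegativeImproperIntegral.

Variables (f : R -> R) (B : R).
Hypothesis f_continuous : forall t, 0 < t -> continuous f t.
Hypothesis f_nonneg : forall t, 0 < t -> 0 <= f t.
Hypothesis RInt_f_le : forall a b, 0 < a <= b -> RInt f a b <= B.

Lemma ex_RInt_positive_segment a b : 0 < a -> 0 < b -> ex_RInt f a b.
Proof.
  intros Ha Hb. apply ex_RInt_continuous_R. intros t Ht. apply f_continuous.
  apply Rlt_le_trans with (2 := proj1 Ht). now apply Rmin_glb_lt.
Qed.

Lemma RInt_segment_incl_le a a' b' b : 0 < a <= a' -> a' <= b' <= b -> RInt f a' b' <= RInt f a b.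
Proof.
  intros Ha Hb.
  rewrite <- (RInt_Chasles (V := R_CompleteNormedModule) f a a' b),
    <- (RInt_Chasles (V := R_CompleteNormedModule) f a' b' b)
    by (apply ex_RInt_positive_segment; lra).
  assert (Hleft : 0 <= RInt f a a').
  { apply RInt_ge_0; [lra|apply ex_RInt_positive_segment; lra|intros; apply f_nonneg; lra]. }
  assert (Hright : 0 <= RInt f b' b).
  { apply RInt_ge_0; [lra|apply ex_RInt_positive_segment; lra|intros; apply f_nonneg; lra]. }
  unfold plus; simpl. lra.
Qed.

Lemma is_RInt_gen_nonneg_bounded :
  exists l, is_RInt_gen f (at_right 0) (Rbar_locally p_infty) l /\
    forall a b, 0 < a <= b -> RInt f a b <= l.
Proof.
  set (values := fun v => exists a b, 0 < a <= b /\ v = RInt f a b).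
  destruct (completeness values) as [l [Hupper Hleast]].
  { exists B. intros v (a & b & Hab & ->). now apply RInt_f_le. }
  { exists (RInt f 1 1), 1, 1. split; [lra|easy]. }
  assert (Hle : forall a b, 0 < a <= b -> RInt f a b <= l).
  { intros a b Hab. apply Hupper. now exists a, b. }
  exists l. split; [|exact Hle]. intros P [eps HP].
  assert (Happrox : exists a b, 0 < a <= b /\ l - eps < RInt f a b).
  { apply Classical_Prop.NNPP. intros Hnone. assert (l <= l - eps).
    { apply Hleast. intros v (a & b & Hab & ->). apply Rnot_lt_le. intros Hlt.
      apply Hnone. now exists a, b. }
    generalize (cond_pos eps). lra. }
  destruct Happrox as (a0 & b0 & Hab0 & Hlt). assert (Ha0 : 0 < a0) by lra.
  apply (Filter_prod _ _ _ (fun a => 0 < a < a0) (fun b => b0 < b)).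
  - exists (mkposreal a0 Ha0). intros a Hball Ha. split; [easy|].
    change (Rabs (a - 0) < a0) in Hball. apply Rabs_def2 in Hball. lra.
  - now exists b0.
  - intros a b Ha Hb. exists (RInt f a b). simpl. split.
    + apply (RInt_correct (V := R_CompleteNormedModule)), ex_RInt_positive_segment; lra.
    + apply HP. change (Rabs (RInt f a b - l) < eps).
      assert (Hincr : RInt f a0 b0 <= RInt f a b) by (apply RInt_segment_incl_le; lra).
      assert (Hab := Hle a b ltac:(lra)). apply Rabs_def1; generalize (cond_pos eps); lra.
Qed.

End NonnegativeImproperIntegral.

Definition gamma_fun (s t : R) : R := Rpower t (s - 1) * exp (- t).

Lemma gamma_fun_pos s t : 0 < gamma_fun s t.
Proof. apply Rmult_lt_0_compat; apply exp_pos. Qed.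

Lemma continuous_gamma_fun s t : 0 < t -> continuous (gamma_fun s) t.
Proof.
  intros Ht. apply continuous_of_ex_derive. unfold gamma_fun, Rpower. auto_derive. lra.
Qed.

(* From [ln (t / (2 s)) <= t / (2 s)] one gets [(s - 1) ln t <= (s - 1) ln (2 s) + t / 2]. *)
Lemma gamma_fun_le s t : 1 <= s -> 0 < t ->
  gamma_fun s t <= exp ((s - 1) * ln (2 * s)) * exp (- t / 2).
Proof.
  intros Hs Ht. unfold gamma_fun, Rpower. rewrite <- !exp_plus. apply exp_le_compat.
  assert (Hquot : 0 < t / (2 * s)) by (apply Rdiv_lt_0_compat; lra).
  assert (Hln : ln t <= ln (2 * s) + t / (2 * s)).
  { replace (ln t) with (ln (2 * s) + ln (t / (2 * s))).
    - generalize (exp_ineq1_le (ln (t / (2 * s)))). rewrite exp_ln by easy. lra.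
    - rewrite <- ln_mult by lra. f_equal. field. lra. }
  assert (Hmul : (s - 1) * ln t <= (s - 1) * (ln (2 * s) + t / (2 * s)))
    by (apply Rmult_le_compat_l; lra).
  replace ((s - 1) * (ln (2 * s) + t / (2 * s)))
    with ((s - 1) * ln (2 * s) + (t / 2 - t / (2 * s))) in Hmul by (field; lra).
  lra.
Qed.

Lemma RInt_gamma_fun_le s a b : 1 <= s -> 0 < a <= b ->
  RInt (gamma_fun s) a b <= 2 * exp ((s - 1) * ln (2 * s)).
Proof.
  intros Hs Hab. set (K := exp ((s - 1) * ln (2 * s))).
  assert (HK : 0 < K) by apply exp_pos.
  assert (HI : is_RInt (fun t => K * exp (- t / 2)) a b
     (minus (- 2 * K * exp (- b / 2)) (- 2 * K * exp (- a / 2)))).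
  { apply (is_RInt_derive (fun t => - 2 * K * exp (- t / 2))).
    - intros t _. auto_derive; [easy|]. unfold Rdiv. now field_simplify_eq.
    - intros t _. apply continuous_of_ex_derive. auto_derive; easy. }
  apply Rle_trans with (RInt (fun t => K * exp (- t / 2)) a b).
  - apply RInt_le; [lra| |eexists; exact HI|intros t Ht; apply gamma_fun_le; lra].
    apply ex_RInt_positive_segment; [apply continuous_gamma_fun|lra|lra].
  - rewrite (is_RInt_unique _ _ _ _ HI). unfold minus, plus, opp; simpl.
    assert (0 < exp (- b / 2)) by apply exp_pos.
    assert (exp (- a / 2) <= 1) by (rewrite <- exp_0; apply exp_le_compat; lra).
    nra.
Qed.

Lemma Gamma_spec s : 1 <= s ->
  0 < Gamma s /\
  is_RInt_gen (gamma_fun s) (at_right 0) (Rbar_locally p_infty) (Gamma s).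
Proof.
  intros Hs.
  destruct (is_RInt_gen_nonneg_bounded (gamma_fun s) (2 * exp ((s - 1) * ln (2 * s))))
    as (l & HI & Hle).
  - apply continuous_gamma_fun.
  - intros; left; apply gamma_fun_pos.
  - intros a b Hab. now apply RInt_gamma_fun_le.
  - assert (HG : Gamma s = l) by (unfold Gamma; apply is_RInt_gen_unique; exact HI).
    rewrite HG. split; [|exact HI].
    apply Rlt_le_trans with (RInt (gamma_fun s) 1 2); [|apply Hle; lra].
    apply RInt_gt_0; [lra|intros; apply gamma_fun_pos|].
    intros; apply continuous_gamma_fun; lra.
Qed.

Lemma is_derive_gamma_fun_succ s t : 0 < t ->
  is_derive (gamma_fun (s + 1)) t (s * gamma_fun s t - gamma_fun (s + 1) t).
Proof.
  intros Ht. unfold gamma_fun, Rpower.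
  replace (s + 1 - 1) with s by ring. auto_derive; [lra|].
  replace ((s - 1) * ln t) with (s * ln t + - ln t) by ring.
  rewrite (exp_plus (s * ln t)), (exp_Ropp (ln t)), exp_ln by lra. field; lra.
Qed.

Lemma filterlim_gamma_fun_0 s : 2 <= s -> filterlim (gamma_fun s) (at_right 0) (locally 0).
Proof.
  intros Hs. apply (filterlim_le_le (fun _ => 0) _ (fun t => t) 0).
  - exists (mkposreal 1 Rlt_0_1). intros t Hball Ht.
    change (Rabs (t - 0) < 1) in Hball. apply Rabs_def2 in Hball.
    split; [left; apply gamma_fun_pos|].
    apply Rle_trans with (exp (ln t) * 1); [|rewrite exp_ln; lra].
    apply Rmult_le_compat; try (left; apply exp_pos).
    + apply exp_le_compat. assert (ln t < ln 1) by (apply ln_increasing; lra).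
      rewrite ln_1 in *. nra.
    + rewrite <- exp_0. apply exp_le_compat. lra.
  - apply filterlim_const.
  - apply filterlim_filter_le_1 with (2 := filterlim_id _ _). apply filter_le_within.
Qed.

Lemma is_lim_gamma_fun_p_infty s : 1 <= s -> is_lim (gamma_fun s) p_infty 0.
Proof.
  intros Hs. set (K := exp ((s - 1) * ln (2 * s))).
  apply is_lim_le_le_loc with (fun _ => 0) (fun t => K * exp (- (/ 2) * t + 0)).
  - exists 0. intros t Ht. split; [left; apply gamma_fun_pos|].
    replace (- (/ 2) * t + 0) with (- t / 2) by field. now apply gamma_fun_le.
  - apply is_lim_const.
  - replace (Finite 0) with (Rbar_mult K 0) by (simpl; f_equal; ring).
    apply is_lim_scal_l, is_lim_comp_lin; [|lra].
    replace (Rbar_mult (- / 2)%R p_infty) with m_infty; [exact is_lim_exp_m|].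
    symmetry. apply is_Rbar_mult_unique, is_Rbar_mult_sym, is_Rbar_mult_p_infty_neg.
    simpl. lra.
Qed.

Lemma Gamma_succ s : 1 <= s -> Gamma (s + 1) = s * Gamma s.
Proof.
  intros Hs.
  destruct (Gamma_spec s Hs) as [_ HG]. destruct (Gamma_spec (s + 1)) as [_ HG1]; [lra|].
  assert (HD :
    is_RInt_gen (Derive (gamma_fun (s + 1))) (at_right 0) (Rbar_locally p_infty) (0 - 0)).
  { apply is_RInt_gen_Derive.
    - apply filter_imp with (2 := positive_segments_near). intros ab Hpos t Ht.
      eexists. apply is_derive_gamma_fun_succ, Hpos, Ht.
    - apply filter_imp with (2 := positive_segments_near). intros ab Hpos t Ht.
      assert (Ht0 := Hpos t Ht).
      apply (continuous_ext_loc _ (fun t => s * gamma_fun s t - gamma_fun (s + 1) t)).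
      + apply (locally_open (fun u => 0 < u)); [apply open_gt| |exact Ht0].
        intros u Hu. symmetry. now apply is_derive_unique, is_derive_gamma_fun_succ.
      + apply (continuous_minus (V := R_NormedModule)); [|now apply continuous_gamma_fun].
        apply (continuous_scal_r (V := R_NormedModule)). now apply continuous_gamma_fun.
    - apply filterlim_gamma_fun_0. lra.
    - apply is_lim_gamma_fun_p_infty. lra. }
  assert (Hparts := is_RInt_gen_minus (V := R_NormedModule) _ _ _ _
    (is_RInt_gen_scal (V := R_NormedModule) _ s _ HG) HD).
  apply (is_RInt_gen_ext _ (gamma_fun (s + 1))) in Hparts.
  - transitivity (minus (scal s (Gamma s)) (0 - 0) : R); [exact (is_RInt_gen_unique _ _ Hparts)|].
    unfold minus, plus, opp, scal; simpl; unfold mult; simpl. ring.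
  - apply filter_imp with (2 := positive_segments_near). intros ab Hpos t Ht.
    rewrite (is_derive_unique _ _ _ (is_derive_gamma_fun_succ s t (Hpos t ltac:(lra)))).
    unfold minus, plus, opp, scal; simpl; unfold mult; simpl. ring.
Qed.

(** * Gegenbauer polynomials *)

Lemma nat_two_step_ind (P : nat -> Prop) :
  P 0%nat -> P 1%nat -> (forall j, P j -> P (S j) -> P (S (S j))) -> forall j, P j.
Proof.
  intros P0 P1 PSS j. cut (P j /\ P (S j)); [easy|].
  induction j as [|j [Pj PSj]]; split; auto.
Qed.

Lemma Gegenbauer_SS lam j x :
  Gegenbauer lam (S (S j)) x =
  (2 * x * (INR j + 1 + lam) * Gegenbauer lam (S j) x
   - (INR j + 2 * lam) * Gegenbauer lam j x) / (INR j + 2).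
Proof.
  assert (Hsnd : forall i, snd (geg_pair lam x i) = Gegenbauer lam (S i) x).
  { intros i. unfold Gegenbauer. simpl. now destruct (geg_pair lam x i). }
  rewrite <- (Hsnd (S j)), <- (Hsnd j).
  unfold Gegenbauer. cbn [geg_pair]. destruct (geg_pair lam x j) as [c0 c1]. cbn [fst snd].
  rewrite S_INR. field. generalize (pos_INR j). lra.
Qed.

(* The shifts by [PS_incr_1] encode the convention that [C_j] vanishes for negative [j]. *)
Lemma Gegenbauer_rec lam x j (C := fun i => Gegenbauer lam i x) :
  INR j * C j = 2 * x * (INR j - 1 + lam) * PS_incr_1 C j
    - (INR j - 2 + 2 * lam) * PS_incr_1 (PS_incr_1 C) j.
Proof.
  unfold C, PS_incr_1. destruct j as [|[|j]].
  - change zero with 0. simpl. ring.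
  - change zero with 0. unfold Gegenbauer; simpl. ring.
  - rewrite Gegenbauer_SS, !S_INR. field. generalize (pos_INR j). lra.
Qed.

Lemma continuous_Gegenbauer (f g : R -> R) j t :
  continuous f t -> continuous g t -> continuous (fun t => Gegenbauer (f t) j (g t)) t.
Proof.
  intros Hf Hg. induction j as [| |j IH0 IH1] using nat_two_step_ind.
  - apply continuous_const.
  - apply (continuous_mult (K := R_AbsRing)); [|exact Hg].
    apply (continuous_mult (K := R_AbsRing)); [apply continuous_const|exact Hf].
  - eapply continuous_ext; [intros s; symmetry; apply Gegenbauer_SS|].
    apply (continuous_mult (K := R_AbsRing)); [|apply continuous_const].
    apply (continuous_minus (V := R_NormedModule)); apply (continuous_mult (K := R_AbsRing));
      [| exact IH1 | | exact IH0].
    + apply (continuous_mult (K := R_AbsRing)).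
      * apply (continuous_mult (K := R_AbsRing)); [apply continuous_const|exact Hg].
      * apply (continuous_plus (V := R_NormedModule)); [apply continuous_const|exact Hf].
    + apply (continuous_plus (V := R_NormedModule)); [apply continuous_const|].
      apply (continuous_mult (K := R_AbsRing)); [apply continuous_const|exact Hf].
Qed.

Lemma Gegenbauer_Rabs_le lam x j : 0 <= lam -> Rabs x <= 1 ->
  Rabs (Gegenbauer lam j x) <= (3 + 2 * lam) ^ j.
Proof.
  intros Hlam Hx. assert (Hx0 := Rabs_pos x).
  induction j as [| |j IH0 IH1] using nat_two_step_ind.
  - unfold Gegenbauer; simpl. rewrite Rabs_R1. lra.
  - unfold Gegenbauer; simpl.
    rewrite !Rabs_mult, (Rabs_pos_eq 2), (Rabs_pos_eq lam) by lra. nra.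
  - assert (Hj := pos_INR j). rewrite Gegenbauer_SS.
    set (C1 := Gegenbauer lam (S j) x) in *. set (C0 := Gegenbauer lam j x) in *.
    set (K := 3 + 2 * lam) in *. assert (HK : 0 < K ^ j) by (apply pow_lt; unfold K; lra).
    unfold Rdiv. rewrite Rabs_mult, (Rabs_pos_eq (/ _)) by (left; apply Rinv_0_lt_compat; lra).
    apply Rmult_le_reg_r with (INR j + 2); [lra|].
    rewrite Rmult_assoc, Rinv_l, Rmult_1_r by lra.
    assert (Hterm1 : Rabs (2 * x * (INR j + 1 + lam) * C1) <= 2 * (INR j + 1 + lam) * (K * K ^ j)).
    { rewrite !Rabs_mult, (Rabs_pos_eq 2), (Rabs_pos_eq (INR j + 1 + lam)) by lra.
      apply Rmult_le_compat; [|apply Rabs_pos| |exact IH1]; nra. }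
    assert (Hterm0 : Rabs ((INR j + 2 * lam) * C0) <= (INR j + 2 * lam) * K ^ j).
    { rewrite Rabs_mult, (Rabs_pos_eq (INR j + 2 * lam)) by lra.
      apply Rmult_le_compat_l; [lra|exact IH0]. }
    assert (Hdom : 2 * (INR j + 1 + lam) * K + (INR j + 2 * lam) <= K * K * (INR j + 2))
      by (unfold K; nra).
    apply Rmult_le_compat_r with (r := K ^ j) in Hdom; [|lra].
    apply Rle_trans with (1 := Rabs_triang _ _). rewrite Rabs_Ropp. simpl pow. lra.
Qed.

Lemma Gegenbauer_CV_radius lam c x : 0 <= lam -> Rabs c <= 1 -> Rabs x < / (3 + 2 * lam) ->
  Rbar_lt (Rabs x) (CV_radius (fun j => Gegenbauer lam j c)).
Proof.
  intros Hlam Hc Hx. apply geometric_bound_CV_radius with 1 (3 + 2 * lam); [lra| |easy].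
  intros j. rewrite Rmult_1_l. now apply Gegenbauer_Rabs_le.
Qed.

Definition quad (c x : R) : R := 1 - 2 * c * x + x ^ 2.

Lemma quad_ge c x : Rabs c <= 1 -> (1 - Rabs x) ^ 2 <= quad c x.
Proof.
  intros Hc. unfold quad. rewrite <- (pow2_abs x).
  assert (Hcx : c * x <= 1 * Rabs x).
  { apply Rle_trans with (1 := Rle_abs _). rewrite Rabs_mult.
    apply Rmult_le_compat_r; [apply Rabs_pos|easy]. }
  simpl. lra.
Qed.

Lemma quad_pos c x : Rabs c <= 1 -> Rabs x < 1 -> 0 < quad c x.
Proof.
  intros Hc Hx. apply Rlt_le_trans with (2 := quad_ge c x Hc). apply pow_lt. lra.
Qed.

Lemma is_derive_quad c x : is_derive (quad c) x (2 * x - 2 * c).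
Proof. unfold quad. auto_derive; [easy|ring]. Qed.

Lemma is_series_quad_mul (a : nat -> R) c x : Rbar_lt (Rabs x) (CV_radius a) ->
  is_series (fun n => (a n - 2 * c * PS_incr_1 a n + PS_incr_1 (PS_incr_1 a) n) * x ^ n)
    (quad c x * PSeries a x).
Proof.
  intros Hx. assert (Ha := is_pseries_PSeries a x Hx).
  assert (Ha1 := is_series_PS_incr_1 _ _ _ Ha). assert (Ha2 := is_series_PS_incr_1 _ _ _ Ha1).
  assert (Hsum := is_series_Rplus _ _ _ _ Ha
    (is_series_Rplus _ _ _ _ (is_series_Rmult_l (- 2 * c) _ _ Ha1) Ha2)).
  replace (quad c x * PSeries a x) with
    (PSeries a x + (- 2 * c * (x * PSeries a x) + x * (x * PSeries a x)))
    by (unfold quad; ring).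
  apply is_series_ext_R with (2 := Hsum). intros n. ring.
Qed.

(* The recurrence says that the sum [f] of the series solves [q f' = - lam q' f]
   for [q = quad c]. *)
Lemma Gegenbauer_generating_ode lam c x : 0 <= lam -> Rabs c <= 1 -> Rabs x < / (3 + 2 * lam) ->
  quad c x * PSeries (PS_derive (fun j => Gegenbauer lam j c)) x =
  lam * (2 * c - 2 * x) * PSeries (fun j => Gegenbauer lam j c) x.
Proof.
  intros Hlam Hc Hx. set (a := fun j => Gegenbauer lam j c).
  assert (Hrad := Gegenbauer_CV_radius lam c x Hlam Hc Hx). fold a in Hrad.
  assert (Hleft := is_series_quad_mul (PS_derive a) c x
    (eq_ind_r (Rbar_lt (Rabs x)) Hrad (CV_radius_derive a))).
  assert (Ha := is_pseries_PSeries a x Hrad). assert (Ha1 := is_series_PS_incr_1 _ _ _ Ha).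
  assert (Hright := is_series_Rplus _ _ _ _ (is_series_Rmult_l (lam * (2 * c)) _ _ Ha)
    (is_series_Rmult_l (- lam * 2) _ _ Ha1)).
  rewrite <- (is_series_unique _ _ Hleft).
  replace (lam * (2 * c - 2 * x) * PSeries a x)
    with (lam * (2 * c) * PSeries a x + - lam * 2 * (x * PSeries a x)) by ring.
  rewrite <- (is_series_unique _ _ Hright). apply Series_ext. intros n.
  assert (Hrec := Gegenbauer_rec lam c (S n)). fold a in Hrec.
  unfold PS_derive, PS_incr_1 in *. rewrite Hrec.
  destruct n as [|[|n]]; try change zero with 0; rewrite !S_INR; simpl; ring.
Qed.

Lemma Gegenbauer_generating_function lam c x :
  0 <= lam -> Rabs c <= 1 -> Rabs x < / (3 + 2 * lam) ->
  is_series (fun j => Gegenbauer lam j c * x ^ j) (Rpower (quad c x) (- lam)).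
Proof.
  intros Hlam Hc Hx. set (a := fun j => Gegenbauer lam j c).
  set (phi := fun t => PSeries a t * exp (lam * ln (quad c t))).
  assert (Hphi : forall t, Rabs t < / (3 + 2 * lam) -> is_derive phi t 0).
  { intros t Ht. unfold phi. assert (Hrad := Gegenbauer_CV_radius lam c t Hlam Hc Ht).
    assert (Hq := quad_pos c t Hc (Rlt_Rinv_lt_1 _ (3 + 2 * lam) ltac:(lra) Ht)).
    assert (Hexp : is_derive (fun t => exp (lam * ln (quad c t))) t
       (lam * ((2 * t - 2 * c) / quad c t) * exp (lam * ln (quad c t)))).
    { auto_derive; [split; [eexists; apply is_derive_quad|easy]|].
      change (Derive (fun x : R => quad c x) t) with (Derive (quad c) t).
      rewrite (is_derive_unique _ _ _ (is_derive_quad c t)). field. lra. }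
    evar_last.
    - apply (is_derive_mult (K := R_AbsRing) (PSeries a) _ t _ _ (is_derive_PSeries _ _ Hrad) Hexp).
      intros; apply Rmult_comm.
    - assert (Hode := Gegenbauer_generating_ode lam c t Hlam Hc Ht). fold a in Hode.
      unfold plus, mult; simpl; fold a. apply Rmult_eq_reg_l with (quad c t); [|lra].
      transitivity ((quad c t * PSeries (PS_derive a) t + lam * (2 * t - 2 * c) * PSeries a t)
        * exp (lam * ln (quad c t))); [field; lra|rewrite Hode; ring]. }
  assert (Hconst := is_derive_zero_constant phi _ x Hphi Hx).
  replace (Rpower (quad c x) (- lam)) with (PSeries a x).
  { apply is_pseries_PSeries. now apply Gegenbauer_CV_radius. }
  unfold phi in Hconst. rewrite PSeries_0 in Hconst.
  replace (quad c 0) with 1 in Hconst by (unfold quad; ring).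
  change (a 0%nat) with 1 in Hconst. rewrite ln_1, Rmult_0_r, exp_0, Rmult_1_l in Hconst.
  rewrite Rpower_Ropp. unfold Rpower. apply Rmult_eq_reg_r with (exp (lam * ln (quad c x))).
  - rewrite Hconst. field. apply Rgt_not_eq, exp_pos.
  - apply Rgt_not_eq, exp_pos.
Qed.

Fixpoint pochhammer (a : R) (k : nat) : R :=
  match k with O => 1 | S k' => pochhammer a k' * (a + INR k') end.

Lemma pochhammer_pos a k : 0 < a -> 0 < pochhammer a k.
Proof.
  intros Ha. induction k as [|k IH]; simpl; [lra|].
  apply Rmult_lt_0_compat; [easy|]. generalize (pos_INR k). lra.
Qed.

Lemma Gegenbauer_at_1 lam j : Gegenbauer lam j 1 = pochhammer (2 * lam) j / INR (fact j).
Proof.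
  induction j as [| |j IH0 IH1] using nat_two_step_ind.
  - unfold Gegenbauer; simpl. field.
  - unfold Gegenbauer; simpl. field.
  - rewrite Gegenbauer_SS, IH0, IH1, !fact_simpl, !mult_INR.
    cbn [pochhammer]. rewrite !S_INR. assert (Hj := pos_INR j).
    field. repeat split; try lra. apply INR_fact_neq_0.
Qed.

Lemma Gegenbauer_pred_param nu x j (D := fun i => Gegenbauer (nu + 1) i x) :
  Gegenbauer nu j x = D j - 2 * x * PS_incr_1 D j + PS_incr_1 (PS_incr_1 D) j.
Proof.
  assert (Hrec := Gegenbauer_rec (nu + 1) x). fold D in Hrec.
  induction j as [| |j IH0 IH1] using nat_two_step_ind.
  - unfold D, PS_incr_1, Gegenbauer; simpl. change zero with 0. ring.
  - unfold D, PS_incr_1, Gegenbauer; simpl. change zero with 0. ring.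
  - rewrite Gegenbauer_SS, IH0, IH1. assert (Hj := pos_INR j).
    assert (Hrec0 := Hrec j). assert (Hrec1 := Hrec (S j)). assert (Hrec2 := Hrec (S (S j))).
    rewrite !S_INR in *. cbn [PS_incr_1] in *.
    apply Rmult_eq_reg_l with (INR j + 2); [|lra].
    replace ((INR j + 2) * (D (S (S j)) - 2 * x * D (S j) + D j))
      with ((INR j + 1 + 1) * D (S (S j)) - 2 * x * ((INR j + 1) * D (S j))
        + INR j * D j + 2 * (D j - x * D (S j))) by ring.
    rewrite Hrec2, Hrec1, Hrec0. field. lra.
Qed.

Lemma geg_factor_succ_param lam j x (D := fun i => Gegenbauer (lam + 1) i x) :
  geg_factor lam j x = D j - PS_incr_1 (PS_incr_1 D) j.
Proof.
  assert (Hneq : forall l, l <> 0 -> (l + INR j) / l * Gegenbauer l j x =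
    Gegenbauer (l + 1) j x - PS_incr_1 (PS_incr_1 (fun i => Gegenbauer (l + 1) i x)) j).
  { intros l Hl. assert (Hrec := Gegenbauer_rec (l + 1) x j).
    rewrite Gegenbauer_pred_param. apply Rmult_eq_reg_l with l; [|easy].
    field_simplify; [|easy]. lra. }
  unfold geg_factor. destruct (Req_EM_T lam 0) as [->|Hlam]; [|now apply Hneq].
  apply (f_equal real (y := Finite _)), is_lim_unique.
  set (g := fun l =>
    Gegenbauer (l + 1) j x - PS_incr_1 (PS_incr_1 (fun i => Gegenbauer (l + 1) i x)) j).
  apply is_lim_ext_loc with g.
  { exists (mkposreal 1 Rlt_0_1). intros l _ Hl. symmetry. now apply Hneq. }
  apply (is_lim_continuity g 0), continuity_pt_filterlim.
  assert (Hcont : forall i, continuous (fun l => Gegenbauer (l + 1) i x) 0).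
  { intros i. apply continuous_Gegenbauer; [|apply continuous_const].
    apply (continuous_plus (V := R_NormedModule)); [apply continuous_id|apply continuous_const]. }
  apply (continuous_minus (V := R_NormedModule)); [apply Hcont|].
  destruct j as [|[|j]]; [apply continuous_const..|apply Hcont].
Qed.

Lemma continuous_geg_factor lam j t : continuous (geg_factor lam j) t.
Proof.
  assert (HD : forall i, continuous (fun x => Gegenbauer (lam + 1) i x) t).
  { intros i. apply continuous_Gegenbauer; [apply continuous_const|apply continuous_id]. }
  eapply continuous_ext; [intros x; symmetry; apply geg_factor_succ_param|].
  apply (continuous_minus (V := R_NormedModule)); [apply HD|].
  destruct j as [|[|j]]; [apply continuous_const..|apply HD].
Qed.

Lemma geg_factor_Rabs_le lam x j : 0 <= lam -> Rabs x <= 1 ->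
  Rabs (geg_factor lam j x) <= 2 * (5 + 2 * lam) ^ j.
Proof.
  intros Hlam Hx. rewrite geg_factor_succ_param. set (D := fun i => Gegenbauer (lam + 1) i x).
  assert (HD : forall i, (i <= j)%nat -> Rabs (D i) <= (5 + 2 * lam) ^ j).
  { intros i Hij. apply Rle_trans with ((5 + 2 * lam) ^ i); [|apply Rle_pow; [lra|easy]].
    replace (5 + 2 * lam) with (3 + 2 * (lam + 1)) by ring. apply Gegenbauer_Rabs_le; lra. }
  assert (Hshift : Rabs (PS_incr_1 (PS_incr_1 D) j) <= (5 + 2 * lam) ^ j).
  { unfold PS_incr_1. destruct j as [|[|j]]; [| |apply HD; lia];
      change zero with 0; rewrite Rabs_R0; apply pow_le; lra. }
  apply Rle_trans with (1 := Rabs_triang (D j) _). rewrite Rabs_Ropp.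
  generalize (HD j (le_n j)). lra.
Qed.

Lemma cos_INR_SS_mult j t :
  cos (INR (S (S j)) * t) = 2 * cos t * cos (INR (S j) * t) - cos (INR j * t).
Proof.
  rewrite !S_INR.
  replace ((INR j + 1 + 1) * t) with ((INR j + 1) * t + t) by ring.
  replace (INR j * t) with ((INR j + 1) * t - t) by ring.
  rewrite cos_plus, cos_minus. ring.
Qed.

Lemma geg_factor_lam_0_cos j t : geg_factor 0 (S j) (cos t) = 2 * cos (INR (S j) * t).
Proof.
  rewrite geg_factor_succ_param, Rplus_0_l. cbn [PS_incr_1].
  assert (Hrec : forall i, Gegenbauer 1 (S (S i)) (cos t) =
    2 * cos t * Gegenbauer 1 (S i) (cos t) - Gegenbauer 1 i (cos t)).
  { intros i. rewrite Gegenbauer_SS. field. generalize (pos_INR i). lra. }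
  induction j as [| |j IH0 IH1] using nat_two_step_ind.
  - unfold Gegenbauer; simpl. change zero with 0. rewrite Rmult_1_l. ring.
  - rewrite cos_INR_SS_mult, Hrec. unfold Gegenbauer; simpl.
    rewrite Rmult_1_l, Rmult_0_l, cos_0. ring.
  - rewrite cos_INR_SS_mult, Hrec. cbn [PS_incr_1] in *.
    replace (2 * (2 * cos t * cos (INR (S (S j)) * t) - cos (INR (S j) * t)))
      with (2 * cos t * (2 * cos (INR (S (S j)) * t)) - 2 * cos (INR (S j) * t)) by ring.
    rewrite <- IH0, <- IH1. destruct j as [|j]; cbn [PS_incr_1].
    + change zero with 0. rewrite (Hrec 0%nat). unfold Gegenbauer; simpl. ring.
    + rewrite (Hrec j). ring.
Qed.

(** The weight of [geg_factor nu (p - 2 k) x] in [(2 x)^p / p!], for [mu = nu + 1]. *)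
Definition pow_weight (mu : R) (p k : nat) : R :=
  / (INR (fact k) * pochhammer mu (p - k)).

Lemma pow_weight_Sp mu p k : 0 < mu -> (k <= p)%nat ->
  (mu + INR p - INR k) * pow_weight mu (S p) k = pow_weight mu p k.
Proof.
  intros Hmu Hk. unfold pow_weight. replace (S p - k)%nat with (S (p - k)) by lia.
  cbn [pochhammer]. rewrite minus_INR by easy.
  assert (Hpoch := pochhammer_pos mu (p - k) Hmu). assert (Hkp := le_INR _ _ Hk).
  field. repeat split; try lra. apply INR_fact_neq_0.
Qed.

Lemma pow_weight_SpSk mu p k : INR (S k) * pow_weight mu (S p) (S k) = pow_weight mu p k.
Proof.
  unfold pow_weight. rewrite fact_simpl, mult_INR, Nat.sub_succ, !Rinv_mult.
  rewrite <- !Rmult_assoc, Rinv_r by (apply not_0_INR; lia). ring.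
Qed.

Lemma sum_f_R0_half_add_shift (f g : nat -> R) p : g 0%nat = 0 ->
  (p = (2 * (p / 2))%nat -> g (S (p / 2)) = 0) ->
  (p = S (2 * (p / 2)) -> f (S (p / 2)) = 0) ->
  sum_f_R0 (fun k => f k + g (S k)) (p / 2) = sum_f_R0 (fun k => f k + g k) (S p / 2).
Proof.
  intros Hg0 Heven Hodd. rewrite sum_f_R0_add_shift, Hg0.
  assert (Hdiv := Nat.div_mod_eq p 2). assert (Hmod := Nat.mod_upper_bound p 2).
  assert (HdivS := Nat.div_mod_eq (S p) 2). assert (HmodS := Nat.mod_upper_bound (S p) 2).
  assert (Hparity : (p mod 2 = 0 \/ p mod 2 = 1)%nat) by lia.
  destruct Hparity as [Hp|Hp].
  - replace (S p / 2)%nat with (p / 2)%nat by lia. rewrite Heven by lia. ring.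
  - replace (S p / 2)%nat with (S (p / 2)) by lia. rewrite tech5, Hodd by lia. ring.
Qed.

Lemma pow_Gegenbauer_expansion mu x p : 0 < mu ->
  2 ^ p * x ^ p / INR (fact p) =
  sum_f_R0 (fun k => (mu + INR (p - 2 * k)) * pow_weight mu (S p) k *
    Gegenbauer mu (p - 2 * k) x) (p / 2).
Proof.
  intros Hmu. set (C := fun j => Gegenbauer mu j x).
  induction p as [|p IH].
  - unfold pow_weight, Gegenbauer; simpl. field. lra.
  - set (A := fun k => INR (S p - 2 * k) * C (S p - 2 * k)%nat * pow_weight mu (S p) k).
    set (B := fun k => match k with O => 0 | S k' =>
      (INR (p - 2 * k') + 2 * mu - 1) * PS_incr_1 C (p - 2 * k') * pow_weight mu (S p) k' end).
    assert (Hdiv := Nat.div_mod_eq p 2). assert (HdivS := Nat.div_mod_eq (S p) 2).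
    assert (Hrec : forall k, (k <= p / 2)%nat ->
      2 * x * ((mu + INR (p - 2 * k)) * pow_weight mu (S p) k * C (p - 2 * k)%nat) = A k + B (S k)).
    { intros k Hk. unfold A, B. replace (S p - 2 * k)%nat with (S (p - 2 * k)) by lia.
      assert (HC := Gegenbauer_rec mu x (S (p - 2 * k))). fold C in HC. cbn [PS_incr_1] in HC.
      rewrite HC, S_INR. cbn [PS_incr_1]. ring. }
    assert (Hcollect : forall k, (k <= S p / 2)%nat ->
      (mu + INR (S p - 2 * k)) * pow_weight mu (S (S p)) k * C (S p - 2 * k)%nat * INR (S p)
      = A k + B k).
    { intros k Hk. unfold A, B. rewrite <- (pow_weight_Sp mu (S p) k Hmu) by lia.
      destruct k as [|k].
      - rewrite Nat.mul_0_r, Nat.sub_0_r. simpl (INR 0). ring.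
      - replace (p - 2 * k)%nat with (S (S p - 2 * S k)) by lia. cbn [PS_incr_1].
        rewrite <- (pow_weight_SpSk mu (S p) k), (S_INR (S p - 2 * S k)) by lia.
        rewrite minus_INR, mult_INR by lia.
        simpl (INR 2). rewrite !S_INR. ring. }
    apply Rmult_eq_reg_r with (INR (S p)); [|apply not_0_INR; lia].
    rewrite (Rmult_comm (sum_f_R0 _ _)), <- sum_f_R0_Rmult_l.
    transitivity (2 * x * (2 ^ p * x ^ p / INR (fact p))).
    { rewrite fact_simpl, mult_INR. simpl pow. field.
      split; [apply INR_fact_neq_0|apply not_0_INR; lia]. }
    rewrite IH, <- sum_f_R0_Rmult_l, (sum_eq _ (fun k => A k + B (S k))) by exact Hrec.
    rewrite sum_f_R0_half_add_shift.
    + apply sum_eq. intros k Hk. rewrite <- Hcollect by easy. unfold C. ring.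
    + easy.
    + intros Hp. unfold B. replace (p - 2 * (p / 2))%nat with 0%nat by lia.
      cbn [PS_incr_1]. change zero with 0. ring.
    + intros Hp. unfold A. replace (S p - 2 * S (p / 2))%nat with 0%nat by lia.
      simpl (INR 0). ring.
Qed.

(* Abel summation turns [pow_Gegenbauer_expansion] with parameter [nu + 1] into this one. *)
Lemma pow_geg_factor_expansion nu x p : 0 <= nu ->
  2 ^ p * x ^ p / INR (fact p) =
  sum_f_R0 (fun k => pow_weight (nu + 1) p k * geg_factor nu (p - 2 * k) x) (p / 2).
Proof.
  intros Hnu. assert (Hmu : 0 < nu + 1) by lra.
  rewrite (pow_Gegenbauer_expansion (nu + 1) x p Hmu).
  set (C := fun j => Gegenbauer (nu + 1) j x).
  set (A := fun k => pow_weight (nu + 1) p k * C (p - 2 * k)%nat).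
  set (B := fun k => match k with O => 0 | S k' =>
    - (pow_weight (nu + 1) p k' * PS_incr_1 (PS_incr_1 C) (p - 2 * k')) end).
  assert (Hdiv := Nat.div_mod_eq p 2). assert (Hmod := Nat.mod_upper_bound p 2).
  symmetry. rewrite (sum_eq _ (fun k => A k + B (S k)))
    by (intros k _; rewrite geg_factor_succ_param; unfold A, B, C; ring).
  rewrite sum_f_R0_add_shift. simpl (B 0%nat).
  replace (B (S (p / 2))) with 0.
  - rewrite Rplus_0_r, Rminus_0_r. apply sum_eq. intros k Hk. unfold A, B.
    rewrite <- (pow_weight_Sp (nu + 1) p k Hmu) by lia.
    destruct k as [|k].
    + rewrite Nat.mul_0_r, Nat.sub_0_r. unfold C. simpl (INR 0). ring.
    + replace (p - 2 * k)%nat with (S (S (p - 2 * S k))) by lia. cbn [PS_incr_1].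
      rewrite <- (pow_weight_SpSk (nu + 1) p k), minus_INR, mult_INR by lia.
      simpl (INR 2). unfold C. ring.
  - unfold B. destruct (p - 2 * (p / 2))%nat as [|[|r]] eqn:Hr; [| |lia];
      cbn [PS_incr_1]; change zero with 0; ring.
Qed.

(** * Expectations *)

Definition continuous_fun (f : R -> R) : Prop := forall u, continuous f u.

(** A probability law on [[a, b]], represented by the integral it defines. *)
Record expectation (a b : R) (E : (R -> R) -> R) : Prop := {
  expectation_one : E (fun _ => 1) = 1;
  expectation_linear : forall c f g, continuous_fun f -> continuous_fun g ->
    E (fun u => c * f u + g u) = c * E f + E g;
  expectation_nonneg : forall f, continuous_fun f ->
    (forall u, a <= u <= b -> 0 <= f u) -> 0 <= E f }.

Arguments expectation_one {a b E}.
Arguments expectation_linear {a b E}.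
Arguments expectation_nonneg {a b E}.

Lemma continuous_fun_const (c : R) : continuous_fun (fun _ => c).
Proof. intros u. apply continuous_const. Qed.

Lemma continuous_fun_Rmult_l (c : R) (f : R -> R) :
  continuous_fun f -> continuous_fun (fun u => c * f u).
Proof. intros Hf u. apply (continuous_scal_r (V := R_NormedModule)), Hf. Qed.

Lemma continuous_fun_linear (c : R) (f g : R -> R) :
  continuous_fun f -> continuous_fun g -> continuous_fun (fun u => c * f u + g u).
Proof.
  intros Hf Hg u.
  apply (continuous_plus (V := R_NormedModule)); [now apply continuous_fun_Rmult_l|apply Hg].
Qed.

Lemma continuous_fun_of_ex_derive (f : R -> R) : (forall u, ex_derive f u) -> continuous_fun f.
Proof. intros Hf u. apply continuous_of_ex_derive, Hf. Qed.

Lemma continuous_fun_sum_f_R0 (f : nat -> R -> R) n : (forall i, continuous_fun (f i)) ->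
  continuous_fun (fun u => sum_f_R0 (fun i => f i u) n).
Proof.
  intros Hf u. induction n as [|n IH]; simpl; [apply Hf|].
  apply (continuous_plus (V := R_NormedModule)); [exact IH|apply Hf].
Qed.

Lemma continuous_fun_comp f h :
  continuous_fun f -> continuous_fun h -> continuous_fun (fun t => f (h t)).
Proof. intros Hf Hh t. apply (continuous_comp h f); [apply Hh|apply Hf]. Qed.

Lemma continuous_fun_Rpower h e : continuous_fun h -> (forall t, 0 < h t) ->
  continuous_fun (fun t => Rpower (h t) e).
Proof.
  intros Hh Hpos t. apply (continuous_comp h (fun r => Rpower r e)); [apply Hh|].
  apply continuous_of_ex_derive. unfold Rpower. specialize (Hpos t). auto_derive. easy.
Qed.

Lemma continuous_fun_cos w : continuous_fun (fun u => cos (w * u)).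
Proof. apply continuous_fun_of_ex_derive. intros u. auto_derive. easy. Qed.

Lemma continuous_fun_sin w : continuous_fun (fun u => sin (w * u)).
Proof. apply continuous_fun_of_ex_derive. intros u. auto_derive. easy. Qed.

Section Expectation.

Context {a b : R} {E : (R -> R) -> R} (HE : expectation a b E).

Lemma expectation_le f g : continuous_fun f -> continuous_fun g ->
  (forall u, a <= u <= b -> f u <= g u) -> E f <= E g.
Proof.
  intros Hf Hg Hfg. assert (Hdiff : 0 <= E (fun u => -1 * f u + g u)).
  { apply (expectation_nonneg HE); [now apply continuous_fun_linear|].
    intros u Hu. specialize (Hfg u Hu). lra. }
  rewrite (expectation_linear HE) in Hdiff by easy. lra.
Qed.

Lemma expectation_ext f g : continuous_fun f -> continuous_fun g ->
  (forall u, a <= u <= b -> f u = g u) -> E f = E g.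
Proof.
  intros Hf Hg Hfg.
  apply Rle_antisym; apply expectation_le; try easy; intros u Hu; rewrite Hfg by easy; lra.
Qed.

Lemma expectation_const c : E (fun _ => c) = c.
Proof.
  assert (Hzero : E (fun _ => 0) = 0).
  { assert (Hlin : E (fun _ => 1 * 0 + 0) = 1 * E (fun _ => 0) + E (fun _ => 0)).
    { apply (expectation_linear HE); apply continuous_fun_const. }
    rewrite (expectation_ext (fun _ => 1 * 0 + 0) (fun _ => 0)) in Hlin;
      [lra|apply continuous_fun_const..|intros; ring]. }
  rewrite (expectation_ext _ (fun _ => c * 1 + 0));
    [|apply continuous_fun_const..|intros; ring].
  rewrite (expectation_linear HE), (expectation_one HE), Hzero
    by apply continuous_fun_const.
  ring.
Qed.

Lemma expectation_Rmult_l c f : continuous_fun f -> E (fun u => c * f u) = c * E f.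
Proof.
  intros Hf. rewrite (expectation_ext _ (fun u => c * f u + 0)).
  - rewrite (expectation_linear HE), expectation_const; [ring|easy|].
    apply continuous_fun_const.
  - now apply continuous_fun_Rmult_l.
  - apply continuous_fun_linear; [easy|apply continuous_fun_const].
  - intros; ring.
Qed.

Lemma expectation_sum_f_R0 (f : nat -> R -> R) n : (forall i, continuous_fun (f i)) ->
  E (fun u => sum_f_R0 (fun i => f i u) n) = sum_f_R0 (fun i => E (f i)) n.
Proof.
  intros Hf. induction n as [|n IH]; [easy|].
  rewrite (expectation_ext _ (fun u => 1 * f (S n) u + sum_f_R0 (fun i => f i u) n)).
  - rewrite (expectation_linear HE), IH; [simpl; ring|easy|].
    now apply continuous_fun_sum_f_R0.
  - now apply (continuous_fun_sum_f_R0 f (S n)).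
  - apply continuous_fun_linear; [easy|now apply continuous_fun_sum_f_R0].
  - intros; simpl; ring.
Qed.

Lemma expectation_Rabs_le f M : continuous_fun f ->
  (forall u, a <= u <= b -> Rabs (f u) <= M) -> Rabs (E f) <= M.
Proof.
  intros Hf HM. apply Rabs_le_between. split.
  - rewrite <- (expectation_const (- M)). apply expectation_le; [apply continuous_fun_const|easy|].
    intros u Hu. now apply (Rabs_le_between (f u) M), HM.
  - rewrite <- (expectation_const M). apply expectation_le; [easy|apply continuous_fun_const|].
    intros u Hu. now apply (Rabs_le_between (f u) M), HM.
Qed.

Lemma expectation_is_series_dominated (f : nat -> R -> R) (g : R -> R) (M : nat -> R) :
  (forall N, continuous_fun (f N)) -> continuous_fun g ->
  ex_series M -> (forall N u, a <= u <= b -> Rabs (f N u) <= M N) ->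
  (forall u, a <= u <= b -> is_series (fun N => f N u) (g u)) ->
  is_series (fun N => E (f N)) (E g).
Proof.
  intros Hf Hg [m Hm] HM Hfg. apply is_series_is_lim_seq.
  assert (Hdiff : forall N, continuous_fun (fun u => -1 * sum_f_R0 (fun i => f i u) N + g u)).
  { intros N. apply continuous_fun_linear; [now apply continuous_fun_sum_f_R0|easy]. }
  assert (Htail : forall N, Rabs (E g - sum_f_R0 (fun i => E (f i)) N) <= m - sum_f_R0 M N).
  { intros N. rewrite <- (expectation_sum_f_R0 f N Hf).
    replace (E g - E (fun u => sum_f_R0 (fun i => f i u) N))
      with (E (fun u => -1 * sum_f_R0 (fun i => f i u) N + g u)).
    - apply expectation_Rabs_le; [easy|]. intros u Hu.
      replace (-1 * sum_f_R0 (fun i => f i u) N + g u)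
        with (g u - sum_f_R0 (fun i => f i u) N) by ring.
      apply is_series_tail_le; auto.
    - rewrite (expectation_linear HE);
        [ring|now apply continuous_fun_sum_f_R0|easy]. }
  apply is_series_is_lim_seq in Hm. apply is_lim_seq_spec. intros eps.
  apply is_lim_seq_spec in Hm. destruct (Hm eps) as [N0 HN0]. exists N0. intros N HN.
  specialize (HN0 N HN). rewrite Rabs_minus_sym in HN0 |- *.
  apply Rle_lt_trans with (1 := Htail N), Rle_lt_trans with (2 := HN0), Rle_abs.
Qed.

(* [X = E cos] and [Y = E sin] satisfy [X^2 + Y^2 = E (X cos + Y sin) <= sqrt (X^2 + Y^2)]. *)
Lemma expectation_cos_sin_le_1 w :
  E (fun u => cos (w * u)) ^ 2 + E (fun u => sin (w * u)) ^ 2 <= 1.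
Proof.
  set (X := E (fun u => cos (w * u))). set (Y := E (fun u => sin (w * u))).
  assert (Hcos := continuous_fun_cos w). assert (Hsin := continuous_fun_sin w).
  set (rho := sqrt (X ^ 2 + Y ^ 2)).
  assert (Hrho : rho ^ 2 = X ^ 2 + Y ^ 2).
  { apply pow2_sqrt. generalize (pow2_ge_0 X) (pow2_ge_0 Y). lra. }
  assert (Hrho0 : 0 <= rho) by apply sqrt_pos.
  assert (Hmean : E (fun u => X * cos (w * u) + Y * sin (w * u)) = X ^ 2 + Y ^ 2).
  { rewrite (expectation_linear HE X _ (fun u => Y * sin (w * u)) Hcos).
    - rewrite expectation_Rmult_l by easy. fold X Y. ring.
    - now apply continuous_fun_Rmult_l. }
  assert (Hle : X ^ 2 + Y ^ 2 <= rho).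
  { rewrite <- Hmean, <- (expectation_const rho).
    apply expectation_le; [|apply continuous_fun_const|].
    - apply (continuous_fun_linear X (fun u => cos (w * u)) (fun u => Y * sin (w * u)) Hcos).
      now apply continuous_fun_Rmult_l.
    - intros u _. assert (Hcirc := sin2_cos2 (w * u)). unfold Rsqr in Hcirc.
      apply Rsqr_incr_0_var; [|easy]. rewrite !Rsqr_pow2, Hrho.
      assert (0 <= (X * sin (w * u) - Y * cos (w * u)) ^ 2) by apply pow2_ge_0. nra. }
  rewrite <- Hrho in *. nra.
Qed.

End Expectation.

Lemma expectation_point a b c : a <= c <= b -> expectation a b (fun f => f c).
Proof. intros Hc. split; [easy|easy|]. intros f _ Hf. now apply Hf. Qed.

Lemma expectation_average a b (c : nat -> R) n : (forall k, a <= c k <= b) ->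
  expectation a b (fun f => sum_f_R0 (fun k => f (c k)) n / INR (S n)).
Proof.
  intros Hc. assert (Hn : 0 < INR (S n)) by (apply lt_0_INR; lia). split.
  - rewrite sum_cte. field. lra.
  - intros k f g _ _. rewrite plus_sum, sum_f_R0_Rmult_l. field. lra.
  - intros f _ Hf. apply Rmult_le_pos; [|left; now apply Rinv_0_lt_compat].
    apply cond_pos_sum. intros k. apply Hf, Hc.
Qed.

Lemma expectation_pushforward a b a' b' E h : expectation a b E ->
  continuous_fun h -> (forall t, a <= t <= b -> a' <= h t <= b') ->
  expectation a' b' (fun f => E (fun t => f (h t))).
Proof.
  intros HE Hh Hrange. split.
  - apply (expectation_one HE).
  - intros c f g Hf Hg.
    apply (expectation_linear HE c (fun t => f (h t)) (fun t => g (h t)));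
      now apply continuous_fun_comp.
  - intros f Hf Hpos. apply (expectation_nonneg HE); [now apply continuous_fun_comp|].
    intros t Ht. now apply Hpos, Hrange.
Qed.

Lemma expectation_mixture a b a' b' E (K : R -> (R -> R) -> R) : expectation a b E ->
  (forall v, a <= v <= b -> expectation a' b' (K v)) ->
  (forall f, continuous_fun f -> continuous_fun (fun v => K v f)) ->
  expectation a' b' (fun f => E (fun v => K v f)).
Proof.
  intros HE HK Hcont. split.
  - transitivity (E (fun _ => 1)); [|apply (expectation_one HE)].
    apply (expectation_ext HE); [apply Hcont| |]; try apply continuous_fun_const.
    intros v Hv. apply (expectation_one (HK v Hv)).
  - intros c f g Hf Hg.
    rewrite <- (expectation_linear HE c (fun v => K v f) (fun v => K v g))
      by now apply Hcont.
    apply (expectation_ext HE); [now apply Hcont, continuous_fun_linear| |].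
    + apply continuous_fun_linear; now apply Hcont.
    + intros v Hv. now apply (expectation_linear (HK v Hv)).
  - intros f Hf Hpos. apply (expectation_nonneg HE); [now apply Hcont|].
    intros v Hv. now apply (expectation_nonneg (HK v Hv)).
Qed.

Lemma continuous_fun_expectation a b E (F : R -> R -> R) : expectation a b E ->
  (forall v, continuous_fun (F v)) ->
  (forall v0 (eps : posreal), locally v0 (fun v => forall t, a <= t <= b ->
     Rabs (F v t - F v0 t) < eps)) ->
  continuous_fun (fun v => E (F v)).
Proof.
  intros HE HF Hunif v0. apply filterlim_locally. intros eps.
  assert (Heps : 0 < eps / 2) by (generalize (cond_pos eps); lra).
  apply filter_imp with (2 := Hunif v0 (mkposreal _ Heps)). intros v Hv.
  change (Rabs (E (F v) - E (F v0)) < eps).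
  replace (E (F v) - E (F v0)) with (E (fun t => -1 * F v0 t + F v t))
    by (rewrite (expectation_linear HE) by easy; ring).
  apply Rle_lt_trans with (eps / 2); [|lra].
  apply (expectation_Rabs_le HE); [now apply continuous_fun_linear|].
  intros t Ht. replace (-1 * F v0 t + F v t) with (F v t - F v0 t) by ring.
  left. now apply Hv.
Qed.

(** * Beta and Dirichlet laws *)

Definition wallis (a b : nat) : R := RInt (fun t => sin t ^ a * cos t ^ b) 0 (PI / 2).

(** For [t] distributed by the normalised weight [sin^a cos^b], the law of [sin^2 t] is
    Beta with parameters [beta_param a] and [beta_param b]. *)
Definition beta_mean (a b : nat) (f : R -> R) : R :=
  RInt (fun t => sin t ^ a * cos t ^ b * f t) 0 (PI / 2) / wallis a b.

Definition beta_param (a : nat) : R := (INR a + 1) / 2.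

Lemma beta_param_pos a : 0 < beta_param a.
Proof. unfold beta_param. generalize (pos_INR a). lra. Qed.

Definition beta_param_sum (a b : nat) : R := beta_param a + beta_param b.

Lemma beta_param_sum_pos a b : 0 < beta_param_sum a b.
Proof. unfold beta_param_sum. generalize (beta_param_pos a) (beta_param_pos b). lra. Qed.

Lemma continuous_sin_cos_pow a b t : continuous (fun t => sin t ^ a * cos t ^ b) t.
Proof. apply continuous_of_ex_derive. auto_derive. easy. Qed.

Lemma is_RInt_wallis a b : is_RInt (fun t => sin t ^ a * cos t ^ b) 0 (PI / 2) (wallis a b).
Proof.
  apply (RInt_correct (V := R_CompleteNormedModule)), ex_RInt_continuous_R.
  intros; apply continuous_sin_cos_pow.
Qed.

Lemma wallis_pos a b : 0 < wallis a b.
Proof.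
  assert (HPI := PI_RGT_0). apply RInt_gt_0; [lra| |intros; apply continuous_sin_cos_pow].
  intros t Ht. apply Rmult_lt_0_compat; apply pow_lt; [apply sin_gt_0|apply cos_gt_0]; lra.
Qed.

(* Integrates the derivative of [sin^(a+1) cos^(b+1)]. *)
Lemma wallis_SS a b : (INR a + INR b + 2) * wallis (S (S a)) b = (INR a + 1) * wallis a b.
Proof.
  set (f := fun t => (INR a + 1) * (sin t ^ a * cos t ^ b)
    - (INR a + INR b + 2) * (sin t ^ S (S a) * cos t ^ b)).
  assert (Hprim : is_RInt f 0 (PI / 2)
    (minus (sin (PI / 2) ^ S a * cos (PI / 2) ^ S b) (sin 0 ^ S a * cos 0 ^ S b))).
  { apply (is_RInt_derive (V := R_CompleteNormedModule) (fun t => sin t ^ S a * cos t ^ S b)).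
    - intros t _. unfold f. auto_derive; [easy|].
      change (match a with O => 1 | S _ => INR a + 1 end) with (INR (S a)).
      change (match b with O => 1 | S _ => INR b + 1 end) with (INR (S b)).
      rewrite !S_INR. assert (Hcirc := sin2_cos2 t). unfold Rsqr in Hcirc. simpl pow.
      replace (cos t * cos t ^ b) with (cos t ^ b * cos t) by ring.
      transitivity ((INR a + 1) * (sin t ^ a * cos t ^ b) * (1 - sin t * sin t)
        - (INR b + 1) * (sin t * sin t * sin t ^ a * cos t ^ b)); [|ring].
      replace (1 - sin t * sin t) with (cos t * cos t) by lra. ring.
    - intros t _. apply continuous_of_ex_derive. unfold f. auto_derive. easy. }
  assert (Hlin : is_RInt f 0 (PI / 2) (minus (scal (INR a + 1) (wallis a b))
    (scal (INR a + INR b + 2) (wallis (S (S a)) b)))).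
  { apply (is_RInt_minus (V := R_NormedModule)); apply (is_RInt_scal (V := R_NormedModule));
      apply is_RInt_wallis. }
  apply (is_RInt_unique (V := R_CompleteNormedModule)) in Hprim, Hlin. rewrite Hprim in Hlin.
  rewrite cos_PI2, sin_0 in Hlin.
  unfold minus, plus, opp, scal in Hlin; simpl in Hlin; unfold mult in Hlin; simpl in Hlin. lra.
Qed.

Lemma beta_mean_expectation a b : expectation 0 (PI / 2) (beta_mean a b).
Proof.
  assert (HW := wallis_pos a b). assert (HPI := PI_RGT_0).
  assert (Hint : forall f, continuous_fun f ->
    ex_RInt (fun t => sin t ^ a * cos t ^ b * f t) 0 (PI / 2)).
  { intros f Hf. apply ex_RInt_continuous_R. intros t _.
    apply (continuous_mult (K := R_AbsRing)); [apply continuous_sin_cos_pow|apply Hf]. }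
  unfold beta_mean. split.
  - rewrite (RInt_ext _ (fun t => sin t ^ a * cos t ^ b)) by (intros; apply Rmult_1_r).
    fold (wallis a b). field. lra.
  - intros c f g Hf Hg.
    rewrite (RInt_ext _ (fun t => plus (scal c (sin t ^ a * cos t ^ b * f t))
      (sin t ^ a * cos t ^ b * g t))).
    + rewrite (RInt_plus (V := R_CompleteNormedModule)), (RInt_scal (V := R_CompleteNormedModule)).
      * unfold plus, scal; simpl; unfold mult; simpl. field. lra.
      * now apply Hint.
      * apply (ex_RInt_scal (V := R_NormedModule)). now apply Hint.
      * now apply Hint.
    + intros t _. unfold plus, scal; simpl; unfold mult; simpl. ring.
  - intros f Hf Hpos. apply Rmult_le_pos; [|left; now apply Rinv_0_lt_compat].
    apply RInt_ge_0; [lra|now apply Hint|]. intros t Ht.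
    apply Rmult_le_pos; [|apply Hpos; lra].
    apply Rmult_le_pos; apply pow_le; [apply sin_ge_0|apply cos_ge_0]; lra.
Qed.

Lemma wallis_add_even a b q :
  wallis (a + 2 * q) b =
  wallis a b * (pochhammer (beta_param a) q / pochhammer (beta_param_sum a b) q).
Proof.
  induction q as [|q IH]; [rewrite Nat.mul_0_r, Nat.add_0_r; simpl; field|].
  assert (Hrec := wallis_SS (a + 2 * q) b). rewrite IH in Hrec.
  replace (a + 2 * S q)%nat with (S (S (a + 2 * q))) by lia. cbn [pochhammer].
  assert (Hsum := beta_param_sum_pos a b). assert (Hq := pos_INR q).
  assert (Hpoch := pochhammer_pos _ q Hsum).
  rewrite plus_INR, mult_INR in Hrec. simpl (INR 2) in Hrec.
  apply Rmult_eq_reg_l with (2 * (beta_param_sum a b + INR q)); [|lra].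
  transitivity ((INR a + (1 + 1) * INR q + INR b + 2) * wallis (S (S (a + 2 * q))) b).
  { unfold beta_param_sum, beta_param. field. }
  rewrite Hrec. unfold beta_param_sum, beta_param in *. field. lra.
Qed.

Lemma beta_mean_sin_sq_pow a b q :
  beta_mean a b (fun t => (sin t ^ 2) ^ q) =
  pochhammer (beta_param a) q / pochhammer (beta_param_sum a b) q.
Proof.
  assert (HW := wallis_pos a b). assert (Hpoch := pochhammer_pos _ q (beta_param_sum_pos a b)).
  unfold beta_mean. rewrite (RInt_ext _ (fun t => sin t ^ (a + 2 * q) * cos t ^ b)).
  - fold (wallis (a + 2 * q) b). rewrite wallis_add_even. field. lra.
  - intros t _. rewrite pow_add, pow_mult, !Rmult_assoc. f_equal. apply Rmult_comm.
Qed.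

Lemma is_series_negative_binomial g x : 0 <= g -> Rabs x < / (3 + g) ->
  is_series (fun q => pochhammer g q / INR (fact q) * x ^ q) (Rpower (1 - x) (- g)).
Proof.
  intros Hg Hx. assert (Hx1 := Rlt_Rinv_lt_1 _ (3 + g) ltac:(lra) Hx).
  apply Rabs_def2 in Hx1.
  replace (Rpower (1 - x) (- g)) with (Rpower (quad 1 x) (- (g / 2))).
  - apply is_series_ext_R with (fun q => Gegenbauer (g / 2) q 1 * x ^ q).
    { intros q. rewrite Gegenbauer_at_1. now replace (2 * (g / 2)) with g by field. }
    apply Gegenbauer_generating_function; [lra|rewrite Rabs_R1; lra|].
    now replace (3 + 2 * (g / 2)) with (3 + g) by field.
  - replace (quad 1 x) with ((1 - x) ^ 2) by (unfold quad; ring).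
    rewrite <- Rpower_pow, Rpower_mult by lra. f_equal. simpl (INR 2). field.
Qed.

Lemma sin_sq_cos_sq_bounds t : 0 <= sin t ^ 2 <= 1 /\ cos t ^ 2 = 1 - sin t ^ 2.
Proof.
  assert (Hcirc := sin2_cos2 t). rewrite !Rsqr_pow2 in Hcirc.
  generalize (pow2_ge_0 (sin t)) (pow2_ge_0 (cos t)). lra.
Qed.

Lemma Rabs_mult_sin_sq_le z t : Rabs (z * sin t ^ 2) <= Rabs z.
Proof.
  destruct (sin_sq_cos_sq_bounds t) as [Hsin _].
  rewrite Rabs_mult, (Rabs_pos_eq (sin t ^ 2)) by lra. generalize (Rabs_pos z). nra.
Qed.

Lemma one_minus_mult_sin_sq_pos z t : Rabs z < 1 -> 0 < 1 - z * sin t ^ 2.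
Proof.
  intros Hz. assert (Ht := Rle_lt_trans _ _ _ (Rabs_mult_sin_sq_le z t) Hz).
  apply Rabs_def2 in Ht. lra.
Qed.

Lemma continuous_fun_Rpower_one_minus_mult_sin_sq z e : Rabs z < 1 ->
  continuous_fun (fun t => Rpower (1 - z * sin t ^ 2) e).
Proof.
  intros Hz. apply continuous_fun_Rpower.
  - apply continuous_fun_of_ex_derive. intros t. auto_derive. easy.
  - intros t. now apply one_minus_mult_sin_sq_pos.
Qed.

Lemma is_series_beta_mean_negative_binomial a b z (g := beta_param_sum a b) :
  Rabs z < / (3 + g) ->
  is_series (fun q => pochhammer (beta_param a) q / INR (fact q) * z ^ q)
    (beta_mean a b (fun t => Rpower (1 - z * sin t ^ 2) (- g))).
Proof.
  intros Hz. assert (Hg : 0 < g) by apply beta_param_sum_pos.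
  assert (HE := beta_mean_expectation a b).
  set (coef := fun q => pochhammer g q / INR (fact q)).
  assert (Hcoef : forall q, 0 <= coef q).
  { intros q. left. apply Rdiv_lt_0_compat; [now apply pochhammer_pos|apply INR_fact_lt_0]. }
  assert (Hpow : forall q, continuous_fun (fun t => (sin t ^ 2) ^ q)).
  { intros q. apply continuous_fun_of_ex_derive. intros t. auto_derive. easy. }
  apply is_series_ext_R with (fun q => beta_mean a b (fun t => coef q * z ^ q * (sin t ^ 2) ^ q)).
  { intros q. rewrite (expectation_Rmult_l HE), beta_mean_sin_sq_pow by easy.
    fold g. unfold coef. assert (Hpoch := pochhammer_pos g q Hg).
    field. split; [apply INR_fact_neq_0|lra]. }
  apply (expectation_is_series_dominated HE) with
    (f := fun q t => coef q * z ^ q * (sin t ^ 2) ^ q) (M := fun q => coef q * Rabs z ^ q).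
  - intros q. now apply continuous_fun_Rmult_l.
  - apply continuous_fun_Rpower_one_minus_mult_sin_sq, (Rlt_Rinv_lt_1 _ (3 + g)); [lra|easy].
  - eexists. apply is_series_negative_binomial; [lra|now rewrite Rabs_Rabsolu].
  - intros q t _. rewrite Rmult_assoc, <- Rpow_mult_distr, Rabs_mult, <- RPow_abs.
    rewrite (Rabs_pos_eq (coef q)) by easy. apply Rmult_le_compat_l; [easy|].
    apply pow_incr. split; [apply Rabs_pos|apply Rabs_mult_sin_sq_le].
  - intros t _. apply is_series_ext_R with (fun q => coef q * (z * sin t ^ 2) ^ q).
    { intros q. rewrite Rpow_mult_distr. ring. }
    apply is_series_negative_binomial; [lra|].
    now apply Rle_lt_trans with (1 := Rabs_mult_sin_sq_le z t).
Qed.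

Lemma beta_mean_negative_binomial a b z : Rabs z < / (3 + beta_param_sum a b) ->
  beta_mean a b (fun t => Rpower (1 - z * sin t ^ 2) (- beta_param_sum a b)) =
  Rpower (1 - z) (- beta_param a).
Proof.
  intros Hz. assert (Ha := beta_param_pos a). assert (Hb := beta_param_pos b).
  rewrite <- (is_series_unique _ _ (is_series_beta_mean_negative_binomial a b z Hz)).
  apply is_series_unique, is_series_negative_binomial; [lra|].
  apply Rlt_Rinv_antitone with (2 := Hz). unfold beta_param_sum. lra.
Qed.

Lemma Rabs_le_1_iff u : Rabs u <= 1 <-> -1 <= u <= 1.
Proof. exact (Rabs_le_between u 1). Qed.

Lemma Rabs_convex_le_1 t x y : 0 <= t <= 1 -> Rabs x <= 1 -> Rabs y <= 1 ->
  Rabs (t * x + (1 - t) * y) <= 1.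
Proof.
  intros Ht Hx Hy. apply Rabs_le_1_iff in Hx, Hy. apply Rabs_le_1_iff. split; nra.
Qed.

Definition mix (c v t : R) : R := sin t ^ 2 * c + cos t ^ 2 * v.

Lemma mix_Rabs_le_1 c v t : Rabs c <= 1 -> Rabs v <= 1 -> Rabs (mix c v t) <= 1.
Proof.
  intros Hc Hv. unfold mix. destruct (sin_sq_cos_sq_bounds t) as [Ht ->].
  now apply Rabs_convex_le_1.
Qed.

Lemma continuous_fun_mix c v : continuous_fun (mix c v).
Proof. apply continuous_fun_of_ex_derive. intros t. unfold mix. auto_derive. easy. Qed.

Lemma quad_quotient_near_1 x y s : Rabs x <= 1 -> Rabs y <= 1 -> 8 * Rabs s < 1 ->
  Rabs (1 - quad x s / quad y s) <= 8 * Rabs s.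
Proof.
  intros Hx Hy Hs. assert (Hs0 := Rabs_pos s).
  assert (Hqy : / 2 < quad y s).
  { apply Rlt_le_trans with (2 := quad_ge y s Hy). simpl. nra. }
  replace (1 - quad x s / quad y s) with (2 * s * ((x - y) * / quad y s))
    by (unfold quad in *; field; lra).
  assert (Hxy : Rabs (x - y) <= 2).
  { apply Rabs_le_between in Hx, Hy. apply Rabs_le. lra. }
  assert (Hinv : 0 < / quad y s <= 2).
  { split; [apply Rinv_0_lt_compat; lra|]. rewrite <- (Rinv_inv 2).
    apply Rinv_le_contravar; lra. }
  rewrite !Rabs_mult, (Rabs_pos_eq 2), (Rabs_pos_eq (/ quad y s)) by lra.
  assert (Hprod : Rabs (x - y) * / quad y s <= 2 * 2)
    by (apply Rmult_le_compat; try lra; apply Rabs_pos).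
  nra.
Qed.

Lemma quad_mix x y t s : quad y s <> 0 ->
  quad (mix x y t) s = quad y s * (1 - (1 - quad x s / quad y s) * sin t ^ 2).
Proof.
  intros Hq. unfold mix. destruct (sin_sq_cos_sq_bounds t) as [_ ->].
  unfold quad in *. field. exact Hq.
Qed.

Lemma continuous_fun_Gegenbauer lam N : continuous_fun (Gegenbauer lam N).
Proof. intros u. apply continuous_Gegenbauer; [apply continuous_const|apply continuous_id]. Qed.

Section BetaMixture.

Variables (a b : nat) (x y : R).
Hypotheses (x_bound : Rabs x <= 1) (y_bound : Rabs y <= 1).

Lemma continuous_fun_Rpower_quad_mix s e : Rabs s < 1 ->
  continuous_fun (fun t => Rpower (quad (mix x y t) s) e).
Proof.
  intros Hs. apply continuous_fun_Rpower.
  - apply continuous_fun_of_ex_derive. intros t. unfold quad, mix. auto_derive. easy.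
  - intros t. apply quad_pos; [now apply mix_Rabs_le_1|easy].
Qed.

Lemma beta_mean_quad s : 8 * Rabs s < / (3 + 2 * beta_param_sum a b) ->
  beta_mean a b (fun t => Rpower (quad (mix x y t) s) (- beta_param_sum a b)) =
  Rpower (quad x s) (- beta_param a) * Rpower (quad y s) (- beta_param b).
Proof.
  intros Hs. set (g := beta_param_sum a b) in *.
  assert (Hg : 0 < g) by apply beta_param_sum_pos.
  assert (HE := beta_mean_expectation a b).
  assert (Hs1 := Rlt_Rinv_lt_1 _ (3 + 2 * g) ltac:(lra) Hs).
  assert (Hqx : 0 < quad x s) by (apply quad_pos; lra).
  assert (Hqy : 0 < quad y s) by (apply quad_pos; lra).
  set (z := 1 - quad x s / quad y s).
  assert (Hz : Rabs z < / (3 + g)).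
  { apply Rle_lt_trans with (1 := quad_quotient_near_1 x y s x_bound y_bound Hs1).
    apply Rlt_Rinv_antitone with (2 := Hs). lra. }
  assert (Hz1 := Rlt_Rinv_lt_1 _ (3 + g) ltac:(lra) Hz).
  rewrite (expectation_ext HE _
    (fun t => Rpower (quad y s) (- g) * Rpower (1 - z * sin t ^ 2) (- g))).
  - rewrite (expectation_Rmult_l HE), beta_mean_negative_binomial
      by (easy || now apply continuous_fun_Rpower_one_minus_mult_sin_sq).
    replace (1 - z) with (quad x s * / quad y s) by (unfold z, Rdiv; ring).
    rewrite <- Rpower_mult_distr by (try apply Rinv_0_lt_compat; easy).
    unfold Rpower. rewrite ln_Rinv, <- !exp_plus by easy. f_equal.
    unfold g, beta_param_sum. ring.
  - apply continuous_fun_Rpower_quad_mix. lra.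
  - now apply continuous_fun_Rmult_l, continuous_fun_Rpower_one_minus_mult_sin_sq.
  - intros t _. rewrite Rpower_mult_distr by (easy || now apply one_minus_mult_sin_sq_pos).
    unfold z. now rewrite <- quad_mix by lra.
Qed.

Lemma is_series_beta_mean_Gegenbauer s : 8 * Rabs s < / (3 + 2 * beta_param_sum a b) ->
  is_series
    (fun N => beta_mean a b (fun t => Gegenbauer (beta_param_sum a b) N (mix x y t)) * s ^ N)
    (Rpower (quad x s) (- beta_param a) * Rpower (quad y s) (- beta_param b)).
Proof.
  intros Hs. rewrite <- beta_mean_quad by easy.
  set (g := beta_param_sum a b) in *. assert (Hg : 0 < g) by apply beta_param_sum_pos.
  assert (HE := beta_mean_expectation a b). assert (Hs0 := Rabs_pos s).
  assert (Hsg : Rabs s < / (3 + 2 * g)) by lra.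
  assert (Hcont : forall N, continuous_fun (fun t => Gegenbauer g N (mix x y t)))
    by (intros N; apply continuous_fun_comp;
      [apply continuous_fun_Gegenbauer|apply continuous_fun_mix]).
  apply is_series_ext_R with (fun N => beta_mean a b (fun t => s ^ N * Gegenbauer g N (mix x y t))).
  { intros N. rewrite (expectation_Rmult_l HE) by easy. ring. }
  apply (expectation_is_series_dominated HE) with
    (f := fun N t => s ^ N * Gegenbauer g N (mix x y t))
    (M := fun N => ((3 + 2 * g) * Rabs s) ^ N).
  - intros N. now apply continuous_fun_Rmult_l.
  - apply continuous_fun_Rpower_quad_mix, (Rlt_Rinv_lt_1 _ (3 + 2 * g)); [lra|easy].
  - apply ex_series_geom. rewrite Rabs_pos_eq by (apply Rmult_le_pos; lra).
    apply Rmult_lt_reg_l with (/ (3 + 2 * g)); [apply Rinv_0_lt_compat; lra|].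
    rewrite <- Rmult_assoc, Rinv_l; lra.
  - intros N t _. rewrite Rabs_mult, <- RPow_abs, Rpow_mult_distr, Rmult_comm.
    apply Rmult_le_compat_r; [apply pow_le, Rabs_pos|].
    apply Gegenbauer_Rabs_le; [lra|now apply mix_Rabs_le_1].
  - intros t _. eapply is_series_ext_R; [intros N; apply Rmult_comm|].
    apply Gegenbauer_generating_function; [lra|now apply mix_Rabs_le_1|easy].
Qed.

Lemma Gegenbauer_beta_convolution N :
  beta_mean a b (fun t => Gegenbauer (beta_param_sum a b) N (mix x y t)) =
  PS_mult (fun i => Gegenbauer (beta_param a) i x) (fun j => Gegenbauer (beta_param b) j y) N.
Proof.
  assert (Hg := beta_param_sum_pos a b).
  assert (Ha := beta_param_pos a). assert (Hb := beta_param_pos b).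
  assert (Hdelta : 0 < / (8 * (3 + 2 * beta_param_sum a b))) by (apply Rinv_0_lt_compat; lra).
  apply (pseries_coef_unique
    (fun N => beta_mean a b (fun t => Gegenbauer (beta_param_sum a b) N (mix x y t))) _
    (fun s => Rpower (quad x s) (- beta_param a) * Rpower (quad y s) (- beta_param b)) _ Hdelta);
    intros s Hs.
  - apply is_series_beta_mean_Gegenbauer. rewrite Rinv_mult in Hs. lra.
  - assert (Hsx : Rabs s < / (3 + 2 * beta_param a)).
    { apply Rlt_Rinv_antitone with (2 := Hs). unfold beta_param_sum. lra. }
    assert (Hsy : Rabs s < / (3 + 2 * beta_param b)).
    { apply Rlt_Rinv_antitone with (2 := Hs). unfold beta_param_sum. lra. }
    apply is_pseries_R, is_pseries_mult.
    + apply is_pseries_R, Gegenbauer_generating_function; lra.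
    + apply is_pseries_R, Gegenbauer_generating_function; lra.
    + apply Gegenbauer_CV_radius; lra.
    + apply Gegenbauer_CV_radius; lra.
Qed.

End BetaMixture.

Lemma continuous_fun_mix_uniform f c v0 (eps : posreal) : continuous_fun f ->
  locally v0 (fun v => forall t, Rabs (f (mix c v t) - f (mix c v0 t)) < eps).
Proof.
  intros Hf. set (M := Rabs c + Rabs v0 + 1).
  destruct (unifcont_1d f (- M) M (fun u _ => Hf u) eps) as [delta Hdelta].
  exists (mkposreal _ (Rmin_pos _ _ Rlt_0_1 (cond_pos delta))). intros v Hv t.
  change (Rabs (v - v0) < Rmin 1 delta) in Hv.
  assert (Hv1 := Rlt_le_trans _ _ _ Hv (Rmin_l _ _)).
  assert (Hvd := Rlt_le_trans _ _ _ Hv (Rmin_r _ _)).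
  destruct (sin_sq_cos_sq_bounds t) as [Hsin Hcos].
  assert (Hrange : forall u, Rabs u <= Rabs v0 + 1 -> - M <= mix c u t <= M).
  { intros u Hu. apply Rabs_le_between, Rle_trans with (1 := Rabs_triang _ _).
    rewrite !Rabs_mult, Hcos, (Rabs_pos_eq (sin t ^ 2)), (Rabs_pos_eq (1 - sin t ^ 2)) by lra.
    unfold M. generalize (Rabs_pos c) (Rabs_pos u). nra. }
  assert (Hnear : Rabs (mix c v t - mix c v0 t) < delta).
  { replace (mix c v t - mix c v0 t) with (cos t ^ 2 * (v - v0)) by (unfold mix; ring).
    rewrite Rabs_mult, Hcos, (Rabs_pos_eq (1 - sin t ^ 2)) by lra.
    generalize (Rabs_pos (v - v0)). nra. }
  apply Classical_Prop.NNPP. refine (Hdelta (mix c v0 t) (mix c v t) _ _ Hnear); apply Hrange.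
  - lra.
  - replace v with (v0 + (v - v0)) by ring. generalize (Rabs_triang v0 (v - v0)). lra.
Qed.

Lemma continuous_fun_beta_mean_mix a b c f : continuous_fun f ->
  continuous_fun (fun v => beta_mean a b (fun t => f (mix c v t))).
Proof.
  intros Hf.
  apply (continuous_fun_expectation _ _ _ (fun v t => f (mix c v t)) (beta_mean_expectation a b)).
  - intros v. apply continuous_fun_comp; [easy|apply continuous_fun_mix].
  - intros v0 eps. apply filter_imp with (2 := continuous_fun_mix_uniform f c v0 eps Hf).
    intros v Hv t _. apply Hv.
Qed.

(** The law of [sum_k t_k c_k] for [(t_0, ..., t_n)] distributed by the Dirichlet law with all
    parameters equal to [beta_param d]. *)
Fixpoint dirichlet_mean (d : nat) (c : nat -> R) (n : nat) (f : R -> R) : R :=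
  match n with
  | O => f (c 0%nat)
  | S n' => dirichlet_mean d c n' (fun v =>
      beta_mean d (n' * S d + d) (fun t => f (mix (c n) v t)))
  end.

Lemma beta_param_mult d n : beta_param (n * S d + d) = INR (S n) * beta_param d.
Proof. unfold beta_param. rewrite plus_INR, mult_INR, !S_INR. field. Qed.

Section Dirichlet.

Variables (d : nat) (c : nat -> R).
Hypothesis c_bound : forall k, Rabs (c k) <= 1.

Lemma dirichlet_mean_expectation n : expectation (-1) 1 (dirichlet_mean d c n).
Proof.
  induction n as [|n IH].
  - now apply expectation_point, Rabs_le_1_iff.
  - apply (expectation_mixture _ _ _ _ _
      (fun v f => beta_mean d (n * S d + d) (fun t => f (mix (c (S n)) v t))) IH).
    + intros v Hv. apply expectation_pushforward with (1 := beta_mean_expectation _ _).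
      * apply continuous_fun_mix.
      * intros t _. apply Rabs_le_1_iff, mix_Rabs_le_1; [easy|now apply Rabs_le_1_iff].
    + intros f. apply continuous_fun_beta_mean_mix.
Qed.

Lemma dirichlet_mean_Gegenbauer_S n N :
  dirichlet_mean d c (S n) (Gegenbauer (INR (S (S n)) * beta_param d) N) =
  PS_mult (fun i => Gegenbauer (beta_param d) i (c (S n)))
    (fun j => dirichlet_mean d c n (Gegenbauer (INR (S n) * beta_param d) j)) N.
Proof.
  assert (HE := dirichlet_mean_expectation n).
  set (term := fun i v =>
    Gegenbauer (beta_param d) i (c (S n)) * Gegenbauer (INR (S n) * beta_param d) (N - i) v).
  assert (Hterm : forall i, continuous_fun (term i))
    by (intros i; apply continuous_fun_Rmult_l, continuous_fun_Gegenbauer).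
  transitivity (dirichlet_mean d c n (fun v => sum_f_R0 (fun i => term i v) N)).
  - apply (expectation_ext HE).
    + apply continuous_fun_beta_mean_mix, continuous_fun_Gegenbauer.
    + now apply continuous_fun_sum_f_R0.
    + intros v Hv. apply Rabs_le_1_iff in Hv.
      replace (INR (S (S n)) * beta_param d) with (beta_param_sum d (n * S d + d))
        by (unfold beta_param_sum; rewrite beta_param_mult, (S_INR (S n)); ring).
      rewrite Gegenbauer_beta_convolution, beta_param_mult by easy. reflexivity.
  - rewrite (expectation_sum_f_R0 HE) by easy. apply sum_eq. intros i _.
    apply (expectation_Rmult_l HE), continuous_fun_Gegenbauer.
Qed.

Lemma is_series_dirichlet_mean_Gegenbauer n s :
  Rabs s < / (3 + 2 * (INR (S n) * beta_param d)) ->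
  is_series (fun N => dirichlet_mean d c n (Gegenbauer (INR (S n) * beta_param d) N) * s ^ N)
    (exp (- beta_param d * sum_f_R0 (fun k => ln (quad (c k) s)) n)).
Proof.
  assert (Hlam := beta_param_pos d). induction n as [|n IH]; intros Hs.
  - simpl (INR 1) in *. rewrite Rmult_1_l in *.
    apply Gegenbauer_generating_function; [lra|easy|easy].
  - rewrite S_INR in Hs. assert (Hn := pos_INR (S n)).
    assert (Hnlam : 0 <= INR (S n) * beta_param d) by (apply Rmult_le_pos; lra).
    assert (Hs1 : Rabs s < / (3 + 2 * beta_param d)).
    { apply Rlt_Rinv_antitone with (2 := Hs). lra. }
    assert (HsS : Rabs s < / (3 + 2 * (INR (S n) * beta_param d))).
    { apply Rlt_Rinv_antitone with (2 := Hs). lra. }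
    rewrite tech5, Rmult_plus_distr_l, exp_plus, (Rmult_comm (exp _)).
    eapply is_series_ext_R.
    { intros N. apply (f_equal (fun r => r * s ^ N)), eq_sym, dirichlet_mean_Gegenbauer_S. }
    apply is_pseries_R, is_pseries_mult.
    + apply is_pseries_R, Gegenbauer_generating_function; [lra|easy|easy].
    + apply is_pseries_R, IH, HsS.
    + apply Gegenbauer_CV_radius; [lra|easy|easy].
    + apply geometric_bound_CV_radius with 1 (3 + 2 * (INR (S n) * beta_param d)); [lra| |easy].
      intros N. rewrite Rmult_1_l.
      apply (expectation_Rabs_le (dirichlet_mean_expectation n)).
      * apply continuous_fun_Gegenbauer.
      * intros u Hu. apply Gegenbauer_Rabs_le; [easy|now apply Rabs_le_1_iff].
Qed.

End Dirichlet.

(** * Roots of unity *)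

Definition root_angle (n : nat) (th : R) (k : nat) : R := (th + 2 * PI * INR k) / INR n.

Lemma sum_cos_arithmetic alpha beta n :
  2 * sin (beta / 2) * sum_f_R0 (fun k => cos (alpha + INR k * beta)) n =
  sin (alpha + INR (S n) * beta - beta / 2) - sin (alpha - beta / 2).
Proof.
  assert (Hterm : forall t,
    2 * sin (beta / 2) * cos t = sin (t + beta / 2) - sin (t - beta / 2)).
  { intros t. rewrite sin_plus, sin_minus. ring. }
  induction n as [|n IH].
  - cbn [sum_f_R0]. rewrite Hterm. f_equal; f_equal; simpl; field.
  - rewrite tech5, Rmult_plus_distr_l, IH, Hterm, (S_INR (S n)).
    replace (alpha + INR (S n) * beta + beta / 2)
      with (alpha + (INR (S n) + 1) * beta - beta / 2) by field.
    ring.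
Qed.

Lemma sin_rational_multiple_neq_0 N n : (0 < n)%nat -> (N mod n <> 0)%nat ->
  sin (PI * INR N / INR n) <> 0.
Proof.
  intros Hn Hmod Hsin. assert (Hn0 : INR n <> 0) by (apply not_0_INR; lia).
  destruct (sin_eq_0_0 _ Hsin) as [k Hk]. apply Hmod.
  assert (HN : INR N = IZR k * INR n).
  { apply Rmult_eq_reg_l with (PI / INR n);
      [|apply Rmult_integral_contrapositive_currified; [apply PI_neq0|now apply Rinv_neq_0_compat]].
    transitivity (PI * INR N / INR n); [field; easy|rewrite Hk; field; easy]. }
  rewrite !INR_IZR_INZ, <- mult_IZR in HN. apply eq_IZR in HN.
  apply Nat2Z.inj. rewrite Nat2Z.inj_mod, HN. apply Z.mod_mul. lia.
Qed.

Lemma sum_cos_root_angle n th N :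
  sum_f_R0 (fun k => cos (INR N * root_angle (S n) th k)) n =
  PS_dilate (S n) (fun j => INR (S n) * cos (INR j * th)) N.
Proof.
  assert (Hn : 0 < INR (S n)) by (apply lt_0_INR; lia).
  unfold PS_dilate, root_angle. destruct (Nat.eqb_spec (N mod S n) 0) as [Hmod|Hmod].
  - assert (HN := Nat.div_mod_eq N (S n)). rewrite Hmod, Nat.add_0_r in HN.
    set (j := (N / S n)%nat) in *. clearbody j. subst N.
    rewrite (sum_eq _ (fun _ => cos (INR j * th))).
    + rewrite sum_cte. apply Rmult_comm.
    + intros k _. symmetry. rewrite <- (cos_period _ (j * k)). f_equal.
      rewrite !mult_INR. field. lra.
  - set (beta := 2 * PI * INR N / INR (S n)).
    assert (Hsum := sum_cos_arithmetic (INR N * th / INR (S n)) beta n).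
    replace (INR N * th / INR (S n) + INR (S n) * beta - beta / 2)
      with (INR N * th / INR (S n) - beta / 2 + 2 * INR N * PI) in Hsum
      by (unfold beta; field; lra).
    rewrite sin_period, Rminus_diag in Hsum.
    rewrite (sum_eq _ (fun k => cos (INR N * th / INR (S n) + INR k * beta)))
      by (intros k _; f_equal; unfold beta; field; lra).
    apply Rmult_eq_reg_l with (2 * sin (beta / 2)); [rewrite Hsum; ring|].
    apply Rmult_integral_contrapositive_currified; [lra|].
    replace (beta / 2) with (PI * INR N / INR (S n)) by (unfold beta; field; lra).
    apply sin_rational_multiple_neq_0; [lia|easy].
Qed.

(* At [N = 0] the division by zero gives [0], the constant coefficient of [ln (quad (cos t) x)]. *)
Definition ln_quad_coef (t : R) (N : nat) : R := - 2 * cos (INR N * t) / INR N.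

Lemma ln_quad_coef_0 t : ln_quad_coef t 0 = 0.
Proof. unfold ln_quad_coef. simpl (INR 0). unfold Rdiv. rewrite Rinv_0. ring. Qed.

Lemma ln_quad_coef_CV_radius t x : Rabs x < 1 -> Rbar_lt (Rabs x) (CV_radius (ln_quad_coef t)).
Proof.
  intros Hx. apply geometric_bound_CV_radius with 2 1; [lra| |now rewrite Rinv_1].
  intros N. rewrite pow1. destruct N as [|N]; [rewrite ln_quad_coef_0, Rabs_R0; lra|].
  unfold ln_quad_coef, Rdiv. assert (HN : 1 <= INR (S N)) by (apply (le_INR 1); lia).
  assert (Hcos : Rabs (cos (INR (S N) * t)) <= 1) by (apply Rabs_le, COS_bound).
  assert (Hinv : 0 < / INR (S N) <= 1).
  { split; [apply Rinv_0_lt_compat; lra|]. rewrite <- Rinv_1. now apply Rinv_le_contravar; [lra|]. }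
  rewrite !Rabs_mult, (Rabs_left (- 2)), (Rabs_pos_eq (/ _)) by lra.
  generalize (Rabs_pos (cos (INR (S N) * t))). nra.
Qed.

Lemma ln_quad_ode t x : Rabs x < 1 ->
  quad (cos t) x * PSeries (PS_derive (ln_quad_coef t)) x = 2 * x - 2 * cos t.
Proof.
  intros Hx.
  assert (Hderive : forall N, PS_derive (ln_quad_coef t) N = - 2 * cos (INR (S N) * t)).
  { intros N. unfold PS_derive, ln_quad_coef. field. apply not_0_INR. lia. }
  assert (Hquad := is_series_quad_mul (PS_derive (ln_quad_coef t)) (cos t) x
    (eq_ind_r (Rbar_lt (Rabs x)) (ln_quad_coef_CV_radius t x Hx) (CV_radius_derive _))).
  rewrite <- (is_series_unique _ _ Hquad). apply is_series_unique.
  apply is_series_is_lim_seq, (is_lim_seq_incr_1 (sum_f_R0 _)).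
  apply is_lim_seq_ext with (fun _ => 2 * x - 2 * cos t); [|apply is_lim_seq_const].
  intros N. induction N as [|N IH]; rewrite tech5.
  - cbn [sum_f_R0 PS_incr_1]. rewrite !Hderive, cos_INR_SS_mult. change zero with 0.
    simpl INR. rewrite Rmult_1_l, Rmult_0_l, cos_0. ring.
  - rewrite <- IH. cbn [PS_incr_1]. rewrite !Hderive, (cos_INR_SS_mult (S N)). ring.
Qed.

Lemma is_series_ln_quad t x : Rabs x < 1 ->
  is_series (fun N => ln_quad_coef t N * x ^ N) (ln (quad (cos t) x)).
Proof.
  intros Hx. assert (Hcos : Rabs (cos t) <= 1) by (apply Rabs_le, COS_bound).
  set (phi := fun s => PSeries (ln_quad_coef t) s - ln (quad (cos t) s)).
  assert (Hphi : forall s, Rabs s < 1 -> is_derive phi s 0).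
  { intros s Hs. assert (Hq := quad_pos (cos t) s Hcos Hs).
    assert (Hln :
      is_derive (fun s => ln (quad (cos t) s)) s ((2 * s - 2 * cos t) / quad (cos t) s)).
    { auto_derive; [split; [eexists; apply is_derive_quad|easy]|].
      change (Derive (fun x : R => quad (cos t) x) s) with (Derive (quad (cos t)) s).
      rewrite (is_derive_unique _ _ _ (is_derive_quad (cos t) s)). field. lra. }
    evar_last.
    - apply (is_derive_minus (V := R_NormedModule) (PSeries (ln_quad_coef t))); [|exact Hln].
      apply is_derive_PSeries. now apply ln_quad_coef_CV_radius.
    - rewrite <- (ln_quad_ode t s Hs). unfold minus, plus, opp; simpl. field. lra. }
  assert (Hconst := is_derive_zero_constant phi 1 x Hphi Hx). unfold phi in Hconst.
  rewrite PSeries_0, ln_quad_coef_0 in Hconst.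
  replace (quad (cos t) 0) with 1 in Hconst by (unfold quad; ring). rewrite ln_1 in Hconst.
  replace (ln (quad (cos t) x)) with (PSeries (ln_quad_coef t) x) by lra.
  apply is_pseries_PSeries. now apply ln_quad_coef_CV_radius.
Qed.

Lemma is_series_sum (a : nat -> nat -> R) (l : nat -> R) n :
  (forall k, is_series (a k) (l k)) ->
  is_series (fun N => sum_f_R0 (fun k => a k N) n) (sum_f_R0 l n).
Proof.
  intros Ha. induction n as [|n IH]; [apply Ha|].
  exact (is_series_Rplus _ _ _ _ IH (Ha (S n))).
Qed.

Lemma sum_ln_quad_root_angle n th s : Rabs s < 1 ->
  sum_f_R0 (fun k => ln (quad (cos (root_angle (S n) th k)) s)) n =
  ln (quad (cos th) (s ^ S n)).
Proof.
  intros Hs. assert (Hsn : Rabs (s ^ S n) < 1).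
  { rewrite <- RPow_abs. apply pow_lt_1_compat; [split; [apply Rabs_pos|easy]|lia]. }
  assert (Hleft := is_series_sum _ _ n (fun k => is_series_ln_quad (root_angle (S n) th k) s Hs)).
  assert (Hright := is_series_PS_dilate_pow (S n) _ s _ (Nat.lt_0_succ n)
    (is_series_ln_quad th (s ^ S n) Hsn)).
  rewrite <- (is_series_unique _ _ Hleft), <- (is_series_unique _ _ Hright).
  apply Series_ext. intros N.
  transitivity (- 2 / INR N * sum_f_R0 (fun k => cos (INR N * root_angle (S n) th k)) n * s ^ N).
  - rewrite Rmult_comm, <- Rmult_assoc, <- sum_f_R0_Rmult_l. apply sum_eq. intros k _.
    unfold ln_quad_coef, Rdiv. ring.
  - f_equal. rewrite sum_cos_root_angle, <- PS_dilate_Rmult_l. apply PS_dilate_ext.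
    intros [|j] ->.
    + rewrite Nat.mul_0_r, ln_quad_coef_0. simpl (INR 0). unfold Rdiv. rewrite Rinv_0. ring.
    + unfold ln_quad_coef. rewrite mult_INR. field. split; apply not_0_INR; lia.
Qed.

(** * The law on [[-1, 1]] behind the kernel *)

Lemma dirichlet_mean_Gegenbauer_root_angle d n th N :
  dirichlet_mean d (fun k => cos (root_angle (S n) th k)) n
    (Gegenbauer (INR (S n) * beta_param d) N) =
  PS_dilate (S n) (fun j => Gegenbauer (beta_param d) j (cos th)) N.
Proof.
  set (lam := beta_param d). assert (Hlam : 0 < lam) by apply beta_param_pos.
  assert (Hn : 1 <= INR (S n)) by (apply (le_INR 1); lia).
  assert (Hnlam : lam <= INR (S n) * lam) by nra.
  assert (Hcos : forall t, Rabs (cos t) <= 1) by (intros; apply Rabs_le, COS_bound).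
  set (delta := / (3 + 2 * (INR (S n) * lam))).
  assert (Hdelta : 0 < delta) by (apply Rinv_0_lt_compat; lra).
  apply (pseries_coef_unique (fun N => dirichlet_mean d _ n (Gegenbauer (INR (S n) * lam) N))
    (PS_dilate (S n) (fun j => Gegenbauer lam j (cos th)))
    (fun s => Rpower (quad (cos th) (s ^ S n)) (- lam)) delta Hdelta); intros s Hs;
    assert (Hs1 : Rabs s < 1) by (apply Rlt_Rinv_lt_1 with (2 := Hs); lra).
  - unfold Rpower. rewrite <- sum_ln_quad_root_angle by easy.
    now apply (is_series_dirichlet_mean_Gegenbauer d (fun k => cos (root_angle (S n) th k))).
  - apply is_series_PS_dilate_pow; [lia|]. apply Gegenbauer_generating_function; [lra|easy|].
    apply Rle_lt_trans with (Rabs s).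
    + rewrite <- RPow_abs. assert (Hs0 := Rabs_pos s). simpl pow.
      assert (Hpow : Rabs s ^ n <= 1) by (rewrite <- (pow1 n); apply pow_incr; lra). nra.
    + apply Rlt_Rinv_antitone with (2 := Hs). lra.
Qed.

Lemma geg_factor_lam_pos lam j x : 0 < lam ->
  geg_factor lam j x = (lam + INR j) / lam * Gegenbauer lam j x.
Proof. intros Hlam. unfold geg_factor. destruct (Req_EM_T lam 0); [lra|easy]. Qed.

Lemma geg_factor_deg_0 lam x : geg_factor lam 0 x = 1.
Proof.
  rewrite geg_factor_succ_param. unfold PS_incr_1, Gegenbauer. simpl. change zero with 0. ring.
Qed.

Lemma average_geg_factor_lam_0_root_angle n th N :
  sum_f_R0 (fun k => geg_factor 0 N (cos (root_angle (S n) th k))) n / INR (S n) =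
  PS_dilate (S n) (fun j => geg_factor 0 j (cos th)) N.
Proof.
  assert (Hn : 0 < INR (S n)) by (apply lt_0_INR; lia). destruct N as [|N].
  - unfold PS_dilate. rewrite Nat.Div0.mod_0_l, Nat.Div0.div_0_l. cbn [Nat.eqb].
    rewrite (sum_eq _ (fun _ => 1)) by (intros; apply geg_factor_deg_0).
    rewrite sum_cte, geg_factor_deg_0. field. lra.
  - rewrite (sum_eq _ (fun k => 2 * cos (INR (S N) * root_angle (S n) th k)))
      by (intros; apply geg_factor_lam_0_cos).
    rewrite sum_f_R0_Rmult_l, sum_cos_root_angle, PS_dilate_Rmult_l.
    transitivity (2 * PS_dilate (S n) (fun j => cos (INR j * th)) (S N)); [field; lra|].
    rewrite <- PS_dilate_Rmult_l. apply PS_dilate_ext. intros [|j] Hj; [lia|].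
    symmetry. apply geg_factor_lam_0_cos.
Qed.

Lemma dirichlet_mean_geg_factor_root_angle d n th N (c := fun k => cos (root_angle (S n) th k)) :
  dirichlet_mean d c n (geg_factor (INR (S n) * beta_param d) N) =
  PS_dilate (S n) (fun j => geg_factor (beta_param d) j (cos th)) N.
Proof.
  assert (Hn : 0 < INR (S n)) by (apply lt_0_INR; lia).
  assert (Hlam := beta_param_pos d). set (nu := INR (S n) * beta_param d).
  assert (Hnu : 0 < nu) by (now apply Rmult_lt_0_compat).
  assert (HE : expectation (-1) 1 (dirichlet_mean d c n)).
  { apply dirichlet_mean_expectation. intros k. apply Rabs_le, COS_bound. }
  rewrite (expectation_ext HE _ (fun u => (nu + INR N) / nu * Gegenbauer nu N u)).
  - rewrite (expectation_Rmult_l HE (_ / _) (Gegenbauer nu N))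
      by apply continuous_fun_Gegenbauer.
    unfold nu, c. rewrite dirichlet_mean_Gegenbauer_root_angle, <- PS_dilate_Rmult_l.
    apply PS_dilate_ext. intros j ->. rewrite geg_factor_lam_pos, mult_INR by easy.
    field. lra.
  - intros u. apply continuous_geg_factor.
  - apply continuous_fun_Rmult_l, continuous_fun_Gegenbauer.
  - intros u _. now apply geg_factor_lam_pos.
Qed.

Lemma expectation_geg_factor m n th (lam := (INR m - 2) / 2) : (0 < n)%nat -> (2 <= m)%nat ->
  exists E, expectation (-1) 1 E /\
  forall N, E (geg_factor (INR n * lam) N) = PS_dilate n (fun j => geg_factor lam j (cos th)) N.
Proof.
  intros Hn Hm. destruct n as [|n]; [lia|]. set (c := fun k => cos (root_angle (S n) th k)).
  destruct m as [|[|[|d]]]; [lia|lia| |].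
  - replace lam with 0 by (unfold lam; simpl; field). rewrite Rmult_0_r.
    exists (fun f => sum_f_R0 (fun k => f (c k)) n / INR (S n)). split.
    + apply expectation_average. intros; apply COS_bound.
    + apply average_geg_factor_lam_0_root_angle.
  - replace lam with (beta_param d) by (unfold lam, beta_param; rewrite !S_INR; field).
    exists (dirichlet_mean d c n). split.
    + apply dirichlet_mean_expectation. intros; apply Rabs_le, COS_bound.
    + intros N. apply dirichlet_mean_geg_factor_root_angle.
Qed.

(** * Bessel functions and plane waves *)

Lemma fact_le_pochhammer nu k : 0 <= nu -> INR (fact k) <= pochhammer (nu + 1) k.
Proof.
  intros Hnu. induction k as [|k IH]; [simpl; lra|].
  rewrite fact_simpl, mult_INR, S_INR, Rmult_comm. cbn [pochhammer].
  assert (Hk := pos_INR k). apply Rmult_le_compat; try lra. apply pos_INR.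
Qed.

Lemma pow_weight_bounds nu N k : 0 <= nu ->
  0 < pow_weight (nu + 1) (N + 2 * k) k <= / INR (fact N) * / INR (fact k).
Proof.
  intros Hnu. unfold pow_weight. replace (N + 2 * k - k)%nat with (N + k)%nat by lia.
  assert (Hk := INR_fact_lt_0 k). assert (HN := INR_fact_lt_0 N).
  assert (Hle : INR (fact N) <= pochhammer (nu + 1) (N + k)).
  { apply Rle_trans with (INR (fact (N + k))); [|now apply fact_le_pochhammer].
    apply le_INR, fact_le. lia. }
  split.
  - apply Rinv_0_lt_compat, Rmult_lt_0_compat; lra.
  - rewrite <- Rinv_mult, Rmult_comm. apply Rinv_le_contravar.
    + now apply Rmult_lt_0_compat.
    + apply Rmult_le_compat_r; lra.
Qed.

Definition bessel_term (nu y : R) (N k : nat) : R :=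
  (-1) ^ k * y ^ (N + 2 * k) * pow_weight (nu + 1) (N + 2 * k) k.

Definition reduced_bessel (nu y : R) (N : nat) : R := Series (bessel_term nu y N).

Lemma bessel_term_Rabs_le nu y N k : 0 <= nu ->
  Rabs (bessel_term nu y N k) <= Rabs y ^ N / INR (fact N) * ((y ^ 2) ^ k / INR (fact k)).
Proof.
  intros Hnu. unfold bessel_term. destruct (pow_weight_bounds nu N k Hnu) as [Hpos Hle].
  rewrite !Rabs_mult, pow_1_abs, <- RPow_abs, pow_add, (pow_mult (Rabs y)), pow2_abs.
  rewrite (Rabs_pos_eq (pow_weight _ _ _)), Rmult_1_l by lra.
  replace (Rabs y ^ N / INR (fact N) * ((y ^ 2) ^ k / INR (fact k)))
    with (Rabs y ^ N * (y ^ 2) ^ k * (/ INR (fact N) * / INR (fact k)))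
    by (unfold Rdiv; ring).
  apply Rmult_le_compat_l; [|easy].
  apply Rmult_le_pos; apply pow_le; [apply Rabs_pos|apply pow2_ge_0].
Qed.

Lemma ex_series_Rabs_bessel_term nu y N : 0 <= nu ->
  ex_series (fun k => Rabs (bessel_term nu y N k)).
Proof.
  intros Hnu.
  apply ex_series_Rabs_le with (fun k => Rabs y ^ N / INR (fact N) * ((y ^ 2) ^ k / INR (fact k))).
  - intros k. rewrite Rabs_Rabsolu. now apply bessel_term_Rabs_le.
  - eexists. apply is_series_Rmult_l, is_series_exp.
Qed.

Lemma Series_Rabs_bessel_term_le nu y N : 0 <= nu ->
  Series (fun k => Rabs (bessel_term nu y N k)) <= exp (y ^ 2) * (Rabs y ^ N / INR (fact N)).
Proof.
  intros Hnu.
  assert (Hexp := is_series_Rmult_l (Rabs y ^ N / INR (fact N)) _ _ (is_series_exp (y ^ 2))).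
  rewrite Rmult_comm, <- (is_series_unique _ _ Hexp).
  apply Series_le; [|eexists; exact Hexp].
  intros k. split; [apply Rabs_pos|now apply bessel_term_Rabs_le].
Qed.

Lemma is_series_reduced_bessel nu y N : 0 <= nu ->
  is_series (bessel_term nu y N) (reduced_bessel nu y N).
Proof. intros Hnu. now apply Series_correct, ex_series_Rabs, ex_series_Rabs_bessel_term. Qed.

Lemma BesselJ_reduced_bessel nu N w : 0 <= nu -> 0 < w ->
  Gamma (nu + 1) * BesselJ (INR N + nu) w = Rpower (w / 2) nu * reduced_bessel nu (w / 2) N.
Proof.
  intros Hnu Hw.
  assert (HGamma : forall k, Gamma (INR k + nu + 1) = Gamma (nu + 1) * pochhammer (nu + 1) k).
  { induction k as [|k IH]; cbn [pochhammer].
    - simpl (INR 0). rewrite Rplus_0_l. ring.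
    - assert (Hk := pos_INR k). rewrite S_INR.
      replace (INR k + 1 + nu + 1) with ((INR k + nu + 1) + 1) by ring.
      rewrite Gamma_succ, IH by lra. ring. }
  unfold BesselJ, reduced_bessel. rewrite <- !Series_scal_l.
  apply Series_ext. intros k. destruct (Gamma_spec (nu + 1)) as [HG _]; [lra|].
  replace (INR k + (INR N + nu) + 1) with (INR (N + k) + nu + 1) by (rewrite plus_INR; ring).
  replace (2 * INR k + (INR N + nu)) with (INR (N + 2 * k) + nu)
    by (rewrite plus_INR, mult_INR; simpl (INR 2); ring).
  rewrite HGamma, Rpower_plus, Rpower_pow by lra. unfold bessel_term, pow_weight.
  replace (N + 2 * k - k)%nat with (N + k)%nat by lia.
  assert (Hpoch := pochhammer_pos (nu + 1) (N + k) ltac:(lra)).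
  field. repeat split; try lra. apply INR_fact_neq_0.
Qed.

Section PlaneWave.

Variable phase : nat -> R.
Hypothesis phase_bound : forall N, Rabs (phase N) <= 1.
Hypothesis phase_add : forall N k, phase (N + 2 * k) = (-1) ^ k * phase N.

Lemma is_series_phase_exp x :
  is_series (fun p => phase p * (x ^ p / INR (fact p))) (phase 0 * cos x + phase 1 * sin x).
Proof.
  assert (Hcos : is_series (fun i => cos_n i * (x ^ 2) ^ i) (cos x)).
  { apply is_series_Reals. unfold cos. destruct (exist_cos (Rsqr x)) as [l Hl].
    unfold cos_in in Hl. now rewrite Rsqr_pow2 in Hl. }
  assert (Hsin : exists l, is_series (fun i => sin_n i * (x ^ 2) ^ i) l /\ sin x = x * l).
  { unfold sin. destruct (exist_sin (Rsqr x)) as [l Hl]. exists l. split; [|easy].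
    unfold sin_in in Hl. rewrite Rsqr_pow2 in Hl. now apply is_series_Reals. }
  destruct Hsin as (l & Hsin & ->).
  apply is_series_ext_R with (fun p => phase p / INR (fact p) * x ^ p);
    [intros p; unfold Rdiv; ring|].
  apply is_pseries_R. replace (phase 1 * (x * l)) with (x * (phase 1 * l)) by ring.
  apply is_pseries_odd_even; apply is_pseries_R.
  - apply is_series_ext_R with (2 := is_series_Rmult_l (phase 0) _ _ Hcos).
    intros i. rewrite (phase_add 0 i : phase (2 * i) = _). unfold cos_n, Rdiv. ring.
  - apply is_series_ext_R with (2 := is_series_Rmult_l (phase 1) _ _ Hsin).
    intros i. rewrite (Nat.add_comm (2 * i) 1), phase_add, Nat.add_comm. unfold sin_n, Rdiv. ring.
Qed.

Variables nu w : R.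
Hypothesis nu_nonneg : 0 <= nu.

Definition plane_wave_term (u : R) (N : nat) : R :=
  phase N * (geg_factor nu N u * reduced_bessel nu (w / 2) N).

Definition plane_wave_bound (N : nat) : R :=
  2 * exp ((w / 2) ^ 2) * (((5 + 2 * nu) * Rabs (w / 2)) ^ N / INR (fact N)).

Lemma ex_series_plane_wave_bound : ex_series plane_wave_bound.
Proof. eexists. apply is_series_Rmult_l, is_series_exp. Qed.

Definition plane_wave_coef (u : R) (N k : nat) : R :=
  phase N * geg_factor nu N u * bessel_term nu (w / 2) N k.

Lemma is_series_plane_wave_coef u N : is_series (plane_wave_coef u N) (plane_wave_term u N).
Proof.
  unfold plane_wave_term. rewrite <- Rmult_assoc.
  now apply is_series_Rmult_l, is_series_reduced_bessel.
Qed.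

Lemma is_series_Rabs_plane_wave_coef u N :
  is_series (fun k => Rabs (plane_wave_coef u N k))
    (Rabs (phase N * geg_factor nu N u) * Series (fun k => Rabs (bessel_term nu (w / 2) N k))).
Proof.
  eapply is_series_ext_R; [intros k; symmetry; apply Rabs_mult|].
  now apply is_series_Rmult_l, Series_correct, ex_series_Rabs_bessel_term.
Qed.

Lemma Series_Rabs_plane_wave_coef_le u N : Rabs u <= 1 ->
  Series (fun k => Rabs (plane_wave_coef u N k)) <= plane_wave_bound N.
Proof.
  intros Hu. rewrite (is_series_unique _ _ (is_series_Rabs_plane_wave_coef u N)).
  unfold plane_wave_bound. rewrite Rpow_mult_distr.
  replace (2 * exp ((w / 2) ^ 2) * ((5 + 2 * nu) ^ N * Rabs (w / 2) ^ N / INR (fact N)))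
    with (2 * (5 + 2 * nu) ^ N * (exp ((w / 2) ^ 2) * (Rabs (w / 2) ^ N / INR (fact N))))
    by (unfold Rdiv; ring).
  apply Rmult_le_compat; [apply Rabs_pos| | |now apply Series_Rabs_bessel_term_le].
  - apply Rle_trans with (2 := Series_Rabs _ (ex_series_Rabs_bessel_term nu (w / 2) N nu_nonneg)).
    apply Rabs_pos.
  - rewrite Rabs_mult, <- Rmult_1_l. apply Rmult_le_compat; try apply Rabs_pos; [easy|].
    now apply geg_factor_Rabs_le.
Qed.

Lemma plane_wave_term_Rabs_le_Series u N :
  Rabs (plane_wave_term u N) <= Series (fun k => Rabs (plane_wave_coef u N k)).
Proof.
  rewrite <- (is_series_unique _ _ (is_series_plane_wave_coef u N)).
  apply Series_Rabs. eexists. apply is_series_Rabs_plane_wave_coef.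
Qed.

Lemma plane_wave_term_Rabs_le u N : Rabs u <= 1 ->
  Rabs (plane_wave_term u N) <= plane_wave_bound N.
Proof.
  intros Hu. apply Rle_trans with (1 := plane_wave_term_Rabs_le_Series u N).
  now apply Series_Rabs_plane_wave_coef_le.
Qed.

Lemma sum_plane_wave_coef_diagonal u p :
  sum_f_R0 (fun k => plane_wave_coef u (p - 2 * k) k) (p / 2) =
  phase p * ((w * u) ^ p / INR (fact p)).
Proof.
  symmetry. transitivity (phase p * (w / 2) ^ p * (2 ^ p * u ^ p / INR (fact p))).
  { replace ((w * u) ^ p) with ((w / 2) ^ p * 2 ^ p * u ^ p); [unfold Rdiv; ring|].
    rewrite <- !Rpow_mult_distr. f_equal. field. }
  rewrite (pow_geg_factor_expansion nu u p nu_nonneg), <- sum_f_R0_Rmult_l.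
  apply sum_eq. intros k Hk. unfold plane_wave_coef, bessel_term.
  assert (Hp := Nat.div_mod_eq p 2).
  replace p with (p - 2 * k + 2 * k)%nat at 1 by lia. rewrite phase_add.
  replace (p - 2 * k + 2 * k)%nat with p by lia. ring.
Qed.

(* The double series is rearranged by powers of [w]. *)
Lemma is_series_plane_wave u : Rabs u <= 1 ->
  is_series (plane_wave_term u) (phase 0 * cos (w * u) + phase 1 * sin (w * u)).
Proof.
  intros Hu.
  assert (Hdom : ex_series (fun N => Series (fun k => Rabs (plane_wave_coef u N k)))).
  { apply ex_series_Rabs_le with (2 := ex_series_plane_wave_bound). intros N.
    rewrite Rabs_pos_eq; [now apply Series_Rabs_plane_wave_coef_le|].
    apply Rle_trans with (2 := plane_wave_term_Rabs_le_Series u N), Rabs_pos. }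
  destruct (ex_series_Rabs_le _ _ (fun N => plane_wave_term_Rabs_le u N Hu)
    ex_series_plane_wave_bound) as [l Hl].
  assert (Hdiag := is_series_diagonals (plane_wave_coef u) _ _ l (is_series_plane_wave_coef u)
    (fun N => Series_correct _ (ex_intro _ _ (is_series_Rabs_plane_wave_coef u N))) Hdom Hl).
  apply (is_series_ext_R _ _ _ (sum_plane_wave_coef_diagonal u)) in Hdiag.
  rewrite <- (is_series_unique _ _ (is_series_phase_exp (w * u))).
  now rewrite (is_series_unique _ _ Hdiag).
Qed.

Lemma continuous_fun_plane_wave_term N : continuous_fun (fun u => plane_wave_term u N).
Proof.
  apply continuous_fun_Rmult_l. intros u.
  apply (continuous_mult (K := R_AbsRing)); [apply continuous_geg_factor|apply continuous_const].
Qed.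

Lemma is_series_expectation_plane_wave E n (g : nat -> R) : (0 < n)%nat ->
  expectation (-1) 1 E -> (forall N, E (geg_factor nu N) = PS_dilate n g N) ->
  is_series (fun j => phase (n * j) * (g j * reduced_bessel nu (w / 2) (n * j)))
    (phase 0 * E (fun u => cos (w * u)) + phase 1 * E (fun u => sin (w * u))).
Proof.
  intros Hn HE Hg. apply (is_series_PS_dilate n); [easy|].
  assert (Hcos := continuous_fun_cos w).
  assert (Hsin := continuous_fun_Rmult_l (phase 1) _ (continuous_fun_sin w)).
  assert (HM := expectation_is_series_dominated HE (fun N u => plane_wave_term u N)
    (fun u => phase 0 * cos (w * u) + phase 1 * sin (w * u)) plane_wave_bound).
  rewrite (expectation_linear HE _ _ _ Hcos Hsin),
    (expectation_Rmult_l HE _ _ (continuous_fun_sin w)) in HM.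
  apply is_series_ext_R with (fun N => E (fun u => plane_wave_term u N)).
  - intros N. rewrite (expectation_ext HE _
      (fun u => phase N * reduced_bessel nu (w / 2) N * geg_factor nu N u)).
    + rewrite (expectation_Rmult_l HE _ (geg_factor nu N)), Hg, <- PS_dilate_Rmult_l
        by (intros u; apply continuous_geg_factor).
      apply PS_dilate_ext. intros j ->. ring.
    + apply continuous_fun_plane_wave_term.
    + apply continuous_fun_Rmult_l. intros u. apply continuous_geg_factor.
    + intros u _. unfold plane_wave_term. ring.
  - apply HM.
    + apply continuous_fun_plane_wave_term.
    + now apply continuous_fun_linear.
    + apply ex_series_plane_wave_bound.
    + intros N u Hu. now apply plane_wave_term_Rabs_le, Rabs_le_1_iff.
    + intros u Hu. now apply is_series_plane_wave, Rabs_le_1_iff.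
Qed.

End PlaneWave.

(** * The kernel *)

Lemma dotm_self_pos m x : nonzero_vec m x -> 0 < dotm m x x.
Proof.
  intros (i & Hi & Hx). destruct m as [|m]; [lia|]. simpl.
  assert (Hsq : forall k, 0 <= x k * x k) by (intros; apply Rle_0_sqr).
  apply Rlt_le_trans with (x i * x i); [nra|].
  assert (Him : (i <= m)%nat) by lia. clear Hi. induction Him as [|m Him IH].
  - destruct i as [|i]; [apply Rle_refl|]. rewrite tech5.
    generalize (cond_pos_sum (fun k => x k * x k) i Hsq). lra.
  - rewrite tech5. generalize (Hsq (S m)). lra.
Qed.

Lemma dotm_cauchy_schwarz m x y : dotm m x y ^ 2 <= dotm m x x * dotm m y y.
Proof.
  destruct m as [|m]; simpl dotm; [lra|].
  set (A := sum_f_R0 (fun i => x i * x i) m). set (B := sum_f_R0 (fun i => y i * y i) m).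
  set (D := sum_f_R0 (fun i => x i * y i) m).
  assert (Hpos : forall s t, 0 <= s ^ 2 * A + 2 * s * t * D + t ^ 2 * B).
  { intros s t. replace (s ^ 2 * A + 2 * s * t * D + t ^ 2 * B)
      with (sum_f_R0 (fun i => (s * x i + t * y i) ^ 2) m).
    - apply cond_pos_sum. intros; apply pow2_ge_0.
    - unfold A, B, D. rewrite <- !sum_f_R0_Rmult_l, <- !plus_sum.
      apply sum_eq. intros; ring. }
  assert (HA : 0 <= A) by (generalize (Hpos 1 0); lra).
  assert (HB : 0 <= B) by (generalize (Hpos 0 1); lra).
  destruct (Req_dec A 0) as [HA0|HA0].
  - assert (HD : D = 0); [|rewrite HA0, HD; lra].
    destruct (Req_dec B 0) as [HB0|HB0].
    + generalize (Hpos 1 1) (Hpos 1 (-1)). rewrite HA0, HB0. lra.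
    + assert (HBD := Hpos B (- D)). rewrite HA0 in HBD. apply Rsqr_0_uniq, Rle_antisym.
      * apply Rmult_le_reg_l with B; unfold Rsqr; lra.
      * apply Rle_0_sqr.
  - assert (HD := Hpos (- D) A). nra.
Qed.

Lemma normm_pos m x : nonzero_vec m x -> 0 < normm m x.
Proof. intros Hx. now apply sqrt_lt_R0, dotm_self_pos. Qed.

Lemma cosine_bound m x y : nonzero_vec m x -> nonzero_vec m y ->
  -1 <= dotm m x y / (normm m x * normm m y) <= 1.
Proof.
  intros Hx Hy. assert (HA := dotm_self_pos m x Hx). assert (HB := dotm_self_pos m y Hy).
  assert (Hz : 0 < normm m x * normm m y)
    by (apply Rmult_lt_0_compat; now apply normm_pos).
  apply Rabs_le_1_iff. unfold Rdiv. rewrite Rabs_mult, Rabs_inv, (Rabs_pos_eq (_ * _)) by lra.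
  apply Rmult_le_reg_r with (normm m x * normm m y); [easy|].
  rewrite Rmult_assoc, Rinv_l, Rmult_1_r, Rmult_1_l by lra.
  apply Rsqr_incr_0_var; [|lra]. rewrite !Rsqr_pow2, pow2_abs, Rpow_mult_distr.
  unfold normm. rewrite !pow2_sqrt by lra. apply dotm_cauchy_schwarz.
Qed.

Section KernelCoefficients.

Variables (n m : nat) (x y : nat -> R).
Hypotheses (n_pos : (0 < n)%nat) (m_ge_2 : (2 <= m)%nat).

Let lam := (INR m - 2) / 2.
Let z := normm m x * normm m y.

Lemma Rpower_kernel_normalisation (w := INR n * Rpower z (/ INR n)) :
  Rpower (2 / INR n) (INR n * lam) * Rpower z (- lam) * Rpower (w / 2) (INR n * lam) = 1.
Proof.
  assert (Hn : 0 < INR n) by now apply lt_0_INR.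
  set (zn := Rpower z (/ INR n)) in *. assert (Hzn : 0 < zn) by apply exp_pos.
  replace (Rpower z (- lam)) with (Rpower (/ zn) (INR n * lam)).
  - assert (Hquot : 0 < 2 / INR n) by (apply Rdiv_lt_0_compat; lra).
    assert (Hizn : 0 < / zn) by now apply Rinv_0_lt_compat.
    assert (Hw : 0 < w / 2) by (unfold w; generalize (Rmult_lt_0_compat _ _ Hn Hzn); lra).
    rewrite !Rpower_mult_distr by (easy || now apply Rmult_lt_0_compat).
    replace (2 / INR n * / zn * (w / 2)) with 1 by (unfold w; field; lra).
    unfold Rpower. now rewrite ln_1, Rmult_0_r, exp_0.
  - unfold zn. rewrite <- Rpower_Ropp, Rpower_mult. f_equal. field. lra.
Qed.

Lemma kernel_coef_reduced_bessel j :
  kernel_coef (2 / INR n) m x y j =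
  geg_factor lam j (dotm m x y / z) *
  reduced_bessel (INR n * lam) (INR n * Rpower z (/ INR n) / 2) (n * j).
Proof.
  unfold kernel_coef. fold lam z.
  assert (Hn : 0 < INR n) by now apply lt_0_INR.
  assert (Hlam : 0 <= lam).
  { unfold lam. assert (Hm := le_INR _ _ m_ge_2). simpl (INR 2) in Hm. lra. }
  assert (Hnorm := Rpower_kernel_normalisation). cbv zeta in Hnorm.
  set (nu := INR n * lam) in *. assert (Hnu : 0 <= nu) by (apply Rmult_le_pos; lra).
  replace (2 * lam / (2 / INR n)) with nu by (unfold nu; field; lra).
  replace ((2 * lam + 2 / INR n) / (2 / INR n)) with (nu + 1) by (unfold nu; field; lra).
  replace (2 * (INR j + lam) / (2 / INR n)) with (INR (n * j) + nu)
    by (rewrite mult_INR; unfold nu; field; lra).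
  replace (2 / INR n / 2) with (/ INR n) by (field; lra).
  replace (2 / (2 / INR n)) with (INR n) by (field; lra).
  set (w := INR n * Rpower z (/ INR n)) in *.
  assert (Hw : 0 < w) by (apply Rmult_lt_0_compat; [easy|apply exp_pos]).
  assert (HBessel := BesselJ_reduced_bessel nu (n * j) w Hnu Hw).
  set (G := geg_factor _ _ _).
  transitivity (G * (Rpower (2 / INR n) nu * Rpower z (- lam)) *
    (Gamma (nu + 1) * BesselJ (INR (n * j) + nu) w)); [ring|].
  rewrite HBessel.
  transitivity (G * reduced_bessel nu (w / 2) (n * j) *
    (Rpower (2 / INR n) nu * Rpower z (- lam) * Rpower (w / 2) nu)); [ring|].
  rewrite Hnorm. ring.
Qed.

End KernelCoefficients.

Lemma Cmod_pair_le_1 X Y : X ^ 2 + Y ^ 2 <= 1 -> Cmod (X, Y) <= 1.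
Proof. intros HXY. unfold Cmod. rewrite <- sqrt_1. now apply sqrt_le_1_alt. Qed.

Lemma cos_INR_PI k : cos (INR k * PI) = (-1) ^ k.
Proof.
  induction k as [|k IH]; [simpl; now rewrite Rmult_0_l, cos_0|].
  rewrite S_INR, Rmult_plus_distr_r, Rmult_1_l, neg_cos, IH. simpl. ring.
Qed.

Lemma sin_INR_PI k : sin (INR k * PI) = 0.
Proof. apply sin_eq_0_1. exists (Z.of_nat k). now rewrite INR_IZR_INZ. Qed.

Lemma quarter_turns_add N k : INR (N + 2 * k) * (PI / 2) = INR k * PI + INR N * (PI / 2).
Proof. rewrite plus_INR, mult_INR. simpl (INR 2). field. Qed.

Lemma cos_quarter_turns_add N k :
  cos (INR (N + 2 * k) * (PI / 2)) = (-1) ^ k * cos (INR N * (PI / 2)).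
Proof. rewrite quarter_turns_add, cos_plus, cos_INR_PI, sin_INR_PI. ring. Qed.

Lemma sin_quarter_turns_add N k :
  sin (INR (N + 2 * k) * (PI / 2)) = (-1) ^ k * sin (INR N * (PI / 2)).
Proof. rewrite quarter_turns_add, sin_plus, cos_INR_PI, sin_INR_PI. ring. Qed.

Lemma kernel_is_characteristic_function n m x y : (0 < n)%nat -> (2 <= m)%nat ->
  nonzero_vec m x -> nonzero_vec m y -> exists E w, expectation (-1) 1 E /\
  Kernel (2 / INR n) m x y = (E (fun u => cos (w * u)), - E (fun u => sin (w * u))).
Proof.
  intros Hn Hm Hx Hy. set (xi := dotm m x y / (normm m x * normm m y)).
  assert (Hxi : cos (acos xi) = xi) by (apply cos_acos; now apply cosine_bound).
  destruct (expectation_geg_factor m n (acos xi) Hn Hm) as (E & HE & Hgeg).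
  rewrite Hxi in Hgeg. set (nu := INR n * ((INR m - 2) / 2)) in *.
  set (w := INR n * Rpower (normm m x * normm m y) (/ INR n)).
  assert (Hnu : 0 <= nu).
  { assert (Hm2 := le_INR _ _ Hm). simpl (INR 2) in Hm2.
    apply Rmult_le_pos; [apply pos_INR|lra]. }
  assert (Hangle : forall j, PI * INR j / (2 / INR n) = INR (n * j) * (PI / 2)).
  { intros j. rewrite mult_INR. field. apply not_0_INR. lia. }
  exists E, w. split; [exact HE|]. unfold Kernel. f_equal.
  - assert (Hcos := is_series_expectation_plane_wave (fun N => cos (INR N * (PI / 2)))
      (fun N => Rabs_le _ _ (COS_bound _)) cos_quarter_turns_add nu w Hnu E n _ Hn HE Hgeg).
    cbv beta in Hcos. simpl (INR 0) in Hcos. simpl (INR 1) in Hcos.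
    rewrite Rmult_0_l, Rmult_1_l, cos_0, cos_PI2, Rmult_1_l, Rmult_0_l, Rplus_0_r in Hcos.
    apply is_series_unique, is_series_ext_R with (2 := Hcos).
    intros j. now rewrite Hangle, kernel_coef_reduced_bessel.
  - assert (Hsin := is_series_expectation_plane_wave (fun N => sin (INR N * (PI / 2)))
      (fun N => Rabs_le _ _ (SIN_bound _)) sin_quarter_turns_add nu w Hnu E n _ Hn HE Hgeg).
    cbv beta in Hsin. simpl (INR 0) in Hsin. simpl (INR 1) in Hsin.
    rewrite Rmult_0_l, Rmult_1_l, sin_0, sin_PI2, Rmult_1_l, Rmult_0_l, Rplus_0_l in Hsin.
    rewrite <- (is_series_unique _ _ Hsin), <- Series_opp. apply Series_ext.
    intros j. rewrite Hangle, kernel_coef_reduced_bessel by easy. apply Ropp_mult_distr_l_reverse.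
Qed.

Theorem theorem12 (n m : nat) (x y : nat -> R) :
  (0 < n)%nat -> (2 <= m)%nat ->
  nonzero_vec m x -> nonzero_vec m y ->
  Cmod (Kernel (2 / INR n) m x y) <= 1.
Proof.
  intros Hn Hm Hx Hy.
  destruct (kernel_is_characteristic_function n m x y Hn Hm Hx Hy) as (E & w & HE & ->).
  apply Cmod_pair_le_1. replace ((- E (fun u => sin (w * u))) ^ 2)
    with (E (fun u => sin (w * u)) ^ 2) by ring.
  exact (expectation_cos_sin_le_1 HE w).
Qed.
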